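(* Let $K\subset[0,1]$ be a nonempty recursively compact set containing no computable point, and let $T$ be the map of the unit circle $S=\mathbb R/\mathbb Z$ constructed from $K$ (and from auxiliary choices $a_i,b_i,f_i,\epsilon$) as described in the context. Then $T$ is computable but has no computable invariant probability measure.
   Context: Construction of $T$. Let $K\subset[0,1]$ be a nonempty recursively compact set containing no computable point. Then $U=(0,1)\setminus K$ is recursively open; let $(a_i)_{i\ge1},(b_i)_{i\ge1}$ be computable sequences with $0<a_i<b_i<1$ and $U=\bigcup_{i\ge1}(a_i,b_i)$. Let $f_i:[0,1]\to[0,1]$ ($i\geq 1$) be non-decreasing, uniformly computable functions with $f_i(x)>x$ if $x\in(a_i,b_i)$ and $f_i(x)=x$ otherwise (for instance $f_i(x)=2x-a_i$ on $[a_i,\frac{a_i+b_i}2]$ and $f_i(x)=b_i$ on $[\frac{a_i+b_i}2,b_i]$). Since $0,1\notin K$, let $\epsilon>0$ be a rational with $K\subset[\epsilon,1-\epsilon]$. Define $f:[0,1]\to\mathbb R$ by $f(x)=\epsilon$ on $[0,\epsilon]$, $f(x)=x$ on $[\epsilon,1-\epsilon]$, $f(x)=2x-(1-\epsilon)$ on $[1-\epsilon,1]$. Define $T:[0,1]\to\mathbb R$ by $T(x)=\frac12f(x)+\sum_{i\ge1}2^{-i-1}f_i(x)$. Since $T(1)=1+\frac\epsilon2=1+T(0)$, $T$ induces a map of $S=\mathbb R/\mathbb Z$, also denoted $T$. Computability. A set $E\subset\mathbb N$ is r.e. if it is the range of a partial recursive function; sets $(E_n)_n$ are uniformly r.e.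 if $\{(n,i): i\in E_n\}$ is r.e. $\mathbb R$, $[0,1]$ and $S$ are computable metric spaces with their usual distances and (effectively enumerated) rational points as ideal points $s_i$. In a computable metric space with ideal points $(s_i)$, fix an effective enumeration $(q_j)$ of the positive rationals and a recursive bijection $\langle\cdot,\cdot\rangle:\mathbb N^2\to\mathbb N$; the ideal balls are the open balls $B_{\langle i,j\rangle}=B(s_i,q_j)$. A set is recursively open if it is $\bigcup_{i\in E}B_i$ with $E$ r.e.; uniformly in $n$ if $U_n=\bigcup_{i\in E_n}B_i$ with $(E_n)$ uniformly r.e. A point $x$ is computable if there is a total recursive $\varphi$ with $d(s_{\varphi(n)},x)<2^{-n}$ for all $n$. A set $K$ is recursively compact if it is compact and there is a partial recursive function which halts on (a code of) a finite tuple $(i_1,\dots,i_p)$ if and only if $K\subset B_{i_1}\cup\dots\cup B_{i_p}$. A function $g$ is computable if the preimages $g^{-1}(B_n)$ of ideal balls of the target are recursively open uniformly in $n$; functions $g_i$ are uniformly computable if $g_i^{-1}(B_n)$ is recursively open uniformly in $(i,n)$. $PM(S)$ is the set of Borel probability measures on $S$ with the distance $W_1(\mu_1,\mu_2)=\sup_{g}\left|\int g\,d\mu_1-\int g\,d\mu_2\right|$ (supremum over 1-Lipschitz $g:S\to\mathbb R$); it is a computable metric space whose ideal points are the finite rational convex combinations of Dirac measures at rational points. A measure is computable if it is a computable point of this space. $\mu$ is invariant if $\mu(A)=\mu(T^{-1}(A))$ for every Borel $A$. *)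

(* Defs.v *)
From HB Require Import structures.
From Stdlib Require Cantor.
From mathcomp Require Import all_boot all_order all_algebra.
From mathcomp Require Import lra.
From mathcomp Require Import all_classical all_reals all_analysis.

Set Implicit Arguments.
Unset Strict Implicit.
Unset Printing Implicit Defensive.

Import Order.TTheory GRing.Theory Num.Theory.
Import numFieldNormedType.Exports.
Local Open Scope classical_set_scope.
Local Open Scope ring_scope.

(* Definition schemes for the partial recursive functions of k arguments. *)
Inductive recfun : nat -> Type :=
| RFzero k : recfun k
| RFsucc : recfun 1
| RFproj k (i : 'I_k) : recfun k
| RFcomp k m (g : recfun m) (h : 'I_m -> recfun k) : recfun k
| RFprec k (g : recfun k) (h : recfun k.+2) : recfun k.+1
| RFmin k (g : recfun k.+1) : recfun k.

(* [reval p v y]: the partial function defined by p is defined at v, with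
   value y.  Primitive recursion is on the first argument: the sequence s
   lists the successive values s 0, ..., s n.  The value of [RFmin g] at v is
   the least y such that g(y, v) = 0, provided that g(z, v) is defined (and
   nonzero) for all z < y. *)
Fixpoint reval k (p : recfun k) : k.-tuple nat -> nat -> Prop :=
  match p in recfun k return k.-tuple nat -> nat -> Prop with
  | RFzero _ => fun _ y => y = 0%N
  | RFsucc => fun v y => y = (thead v).+1
  | RFproj _ i => fun v y => y = tnth v i
  | RFcomp _ m g h => fun v y => exists w : m.-tuple nat,
      (forall i, reval (h i) v (tnth w i)) /\ reval g w y
  | RFprec _ g h => fun v y => exists s : nat -> nat,
      [/\ reval g (behead_tuple v) (s 0%N),
          forall i, (i < thead v)%N ->
            reval h (cons_tuple i (cons_tuple (s i) (behead_tuple v))) (s i.+1)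
        & y = s (thead v)]
  | RFmin _ g => fun v y => reval g (cons_tuple y v) 0%N /\
      forall z, (z < y)%N -> exists t, reval g (cons_tuple z v) t.+1
  end.

Definition eval1 (p : recfun 1) (x y : nat) : Prop := reval p [tuple x] y.

Definition halts (p : recfun 1) (x : nat) : Prop := exists y, eval1 p x y.

Definition total_recursive (phi : nat -> nat) : Prop :=
  exists p : recfun 1, forall n, eval1 p n (phi n).

(* The recursive bijection <.,.> : N^2 -> N (Cantor's) and its inverse. *)
Definition pair_code (i j : nat) : nat := Cantor.to_nat (i, j).
Definition pair_fst (n : nat) : nat := (Cantor.of_nat n).1.
Definition pair_snd (n : nat) : nat := (Cantor.of_nat n).2.

Lemma pair_codeK i j :
  pair_fst (pair_code i j) = i /\ pair_snd (pair_code i j) = j.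
Proof. by rewrite /pair_fst /pair_snd Cantor.cancel_of_to. Qed.

Lemma pair_decodeK n : pair_code (pair_fst n) (pair_snd n) = n.
Proof.
by rewrite /pair_code /pair_fst /pair_snd -surjective_pairing Cantor.cancel_to_of.
Qed.

(* The recursive bijection between finite tuples of integers and N. *)
Fixpoint tuple_code (t : seq nat) : nat :=
  if t is i :: t' then (pair_code i (tuple_code t')).+1 else 0%N.

(* The first argument is fuel: n itself is always enough. *)
Fixpoint tuple_decode_rec (fuel n : nat) : seq nat :=
  match fuel, n with
  | fuel'.+1, m.+1 => pair_fst m :: tuple_decode_rec fuel' (pair_snd m)
  | _, _ => [::]
  end.
Definition tuple_decode (n : nat) : seq nat := tuple_decode_rec n n.

Lemma leq_pair_snd n : (pair_snd n <= n)%N.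
Proof.
rewrite -{2}(pair_decodeK n) /pair_code.
apply: (@leq_trans (pair_snd n + pair_fst n)%N); first exact: leq_addr.
by apply/ssrnat.leP; exact: Cantor.to_nat_non_decreasing.
Qed.

Lemma tuple_decodeK : cancel tuple_decode tuple_code.
Proof.
suff recK k n : (n <= k)%N -> tuple_code (tuple_decode_rec k n) = n.
  by move=> n; exact: recK.
elim: k n => [|k IH] [|n] //= lenk.
by rewrite IH ?pair_decodeK // (leq_trans (leq_pair_snd n)).
Qed.

Lemma tuple_codeK : cancel tuple_code tuple_decode.
Proof.
suff recK k t : (tuple_code t <= k)%N -> tuple_decode_rec k (tuple_code t) = t.
  by move=> t; exact: recK.
elim: t k => [|i t IH] [|k] //=; rewrite ltnS => letk.
have [fstE sndE] := pair_codeK i (tuple_code t); rewrite fstE sndE IH //.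
by apply: leq_trans letk; rewrite -{1}sndE leq_pair_snd.
Qed.

Definition recursively_enumerable (E : set nat) : Prop :=
  exists p : recfun 1, E = [set y | exists x, eval1 p x y].

Definition uniformly_re (E : nat -> set nat) : Prop :=
  recursively_enumerable [set m | E (pair_fst m) (pair_snd m)].

(* The data of a computable metric space that the notions below depend on: a
   set of points, a distance, and an enumeration of the ideal points. *)
Record cms (R : realType) := CMS {
  cms_point :> Type;
  cms_dist : cms_point -> cms_point -> R;
  cms_ideal : nat -> cms_point }.

Section Enumerations.
Context {R : realType}.

Definition pos_rational (j : nat) : R :=
  (pair_fst j).+1%:R / (pair_snd j).+1%:R.

Definition nneg_rational (i : nat) : R :=
  (pair_fst i)%:R / (pair_snd i).+1%:R.

Definition any_rational (i : nat) : R :=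
  ((pair_fst (pair_fst i))%:R - (pair_snd (pair_fst i))%:R) /
  (pair_snd i).+1%:R.

End Enumerations.

Section ComputableMetric.
Context {R : realType}.
Implicit Types X Y : cms R.

Definition ideal_ball X (n : nat) : set X :=
  [set x | cms_dist (cms_ideal X (pair_fst n)) x < pos_rational (pair_snd n)].

Definition uniformly_recursively_open X (U : nat -> set X) : Prop :=
  exists2 E : nat -> set nat, uniformly_re E &
    forall n, U n = \bigcup_(i in E n) ideal_ball i.

Definition computable_point X (x : X) : Prop :=
  exists2 phi : nat -> nat, total_recursive phi &
    forall n, cms_dist (cms_ideal X (phi n)) x < 2^-1 ^+ n.

(* phi <i, n> is the index of an ideal point within 2^-n of x i. *)
Definition computable_sequence X (x : nat -> X) : Prop :=
  exists2 phi : nat -> nat, total_recursive phi &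
    forall i n, cms_dist (cms_ideal X (phi (pair_code i n))) (x i) < 2^-1 ^+ n.

Definition computable_function X Y (g : X -> Y) : Prop :=
  uniformly_recursively_open (fun n => g @^-1` ideal_ball n).

Definition uniformly_computable X Y (g : nat -> X -> Y) : Prop :=
  uniformly_recursively_open
    (fun m => g (pair_fst m) @^-1` ideal_ball (pair_snd m)).

End ComputableMetric.

Arguments ideal_ball {R} X n.
Arguments computable_point {R} X x.
Arguments computable_sequence {R} X x.
Arguments computable_function {R} X Y g.
Arguments uniformly_computable {R} X Y g.

Section RealSpaces.
Context (R : realType).

Definition real_cms : cms R := CMS (fun x y : R => `|x - y|) any_rational.

Lemma min1_ge0 (i : nat) : 0 <= Num.min 1 (nneg_rational i) :> R.
Proof. by rewrite le_min ler01 divr_ge0. Qed.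

Lemma min1_le1 (i : nat) : Num.min 1 (nneg_rational i) <= 1 :> R.
Proof. by rewrite ge_min lexx. Qed.

Definition unit_cms : cms R :=
  CMS (fun x y : {i01 R} => `|x%:num - y%:num|)
      (fun i => Itv01 (min1_ge0 i) (min1_le1 i)).

Definition recursively_compact (K : set R) : Prop :=
  compact K /\
  exists p : recfun 1, forall t : seq nat,
    halts p (tuple_code t) <->
    K `<=` \bigcup_(i in [set` t]) ideal_ball real_cms i.

End RealSpaces.

Section Circle.
Context (R : realType).

Definition eqmodZ (x y : R) : bool := (x - y) \is a Num.int.

Lemma eqmodZ_refl : reflexive eqmodZ.
Proof. by move=> x; rewrite /eqmodZ subrr rpred0. Qed.

Lemma eqmodZ_sym : symmetric eqmodZ.
Proof. by move=> x y; rewrite /eqmodZ -opprB rpredN. Qed.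

Lemma eqmodZ_trans : transitive eqmodZ.
Proof.
move=> y x z; rewrite /eqmodZ => xy yz.
by rewrite -(subrK y x) -addrA rpredD.
Qed.

Canonical eqmodZ_equiv := EquivRel eqmodZ eqmodZ_refl eqmodZ_sym eqmodZ_trans.

(* R/Z, with the quotient topology. *)
Definition circle : Type := quotient_topology {eq_quot eqmodZ_equiv}%qT.

HB.instance Definition _ := PointedTopological.on circle.
HB.instance Definition _ := Quotient.on circle.

Definition to_circle (x : R) : circle := (\pi_circle x)%qT.

Lemma to_circle_eq (x y : R) :
  to_circle x = to_circle y <-> (x - y) \is a Num.int.
Proof. by split=> [/eqmodP|xy]; [|apply/eqmodP]. Qed.

Definition circle_dist (s t : circle) : R :=
  inf [set r | exists x y, [/\ to_circle x = s, to_circle y = t & r = `|x - y|]].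

Definition circle_cms : cms R :=
  CMS circle_dist (fun i => to_circle (nneg_rational i)).

(* The representative in [0,1[ of a point of the circle. *)
Definition circle_frac (s : circle) : R := repr s - (Num.floor (repr s))%:~R.

Lemma circle_frac_ge0 s : 0 <= circle_frac s.
Proof. by rewrite subr_ge0 floor_le. Qed.

Lemma circle_frac_lt1 s : circle_frac s < 1.
Proof. by rewrite ltrBlDl -[1]/(1%:~R) -intrD floorD1_gt. Qed.

Definition circle_lift (s : circle) : {i01 R} :=
  Itv01 (circle_frac_ge0 s) (ltW (circle_frac_lt1 s)).

Lemma to_circle_frac s : to_circle (circle_frac s) = s.
Proof.
rewrite -[RHS](reprK s); apply/to_circle_eq.
by rewrite /circle_frac addrAC subrr add0r rpredN intr_int.
Qed.

(* The map of the circle induced by a map g of [0,1] with g 1 = 1 + g 0. *)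
Definition circle_map (g : {i01 R} -> R) (s : circle) : circle :=
  to_circle (g (circle_lift s)).

Lemma circle_map_to_circle (g : {i01 R} -> R) (x : {i01 R}) :
  g 1%:i01 = 1 + g 0%:i01 ->
  circle_map g (to_circle x%:num) = to_circle (g x).
Proof.
move=> g1; set s := to_circle x%:num; rewrite /circle_map.
have := to_circle_frac s; rewrite {2}/s => /to_circle_eq /intrP[m xm].
have [x0 x1] : 0 <= x%:num :> R /\ x%:num <= 1 :> R by [].
have := circle_frac_ge0 s; have := circle_frac_lt1 s => f1 f0.
have : -1 <= m < 1.
  by rewrite -(ler_int R) -(ltr_int R) -xm; apply/andP; split; lra.
case: m xm => [[|//]|[|//]] xm _.
  by congr (to_circle (g _)); apply/val_inj => /=; apply/eqP; rewrite -subr_eq0 xm.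
have frac0 : circle_frac s = 0 by move: xm; rewrite NegzE; lra.
have -> : circle_lift s = 0%:i01 by apply/val_inj.
have -> : x = 1%:i01 by apply/val_inj => /=; move: xm; rewrite frac0 NegzE; lra.
by apply/to_circle_eq; rewrite g1 opprD addrCA addrN addr0 rpredN rpred1.
Qed.

Definition borel_circle := g_sigma_algebraType (@open circle).

End Circle.

Section Measures.
Context (R : realType).
Local Notation S := (borel_circle R).

Section IdealMeasure.
Variable n : nat.

(* An integer n codes a nonempty finite list of pairs (w, p), where w.+1 is an
   unnormalized weight and p is the index of a rational point. *)
Let terms : seq nat := pair_fst n :: tuple_decode (pair_snd n).

Definition ideal_size : nat := size terms.

Definition ideal_weight (k : nat) : nat := (pair_fst (nth 0%N terms k)).+1.

Definition ideal_atom (k : nat) : S :=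
  cms_ideal (circle_cms R) (pair_snd (nth 0%N terms k)).

Definition ideal_total : nat := (\sum_(k < ideal_size) ideal_weight k)%N.

Definition ideal_measure_fun : set S -> \bar R :=
  msum (fun k => mscale ((ideal_weight k)%:R / ideal_total%:R)%:nng
                        (dirac (ideal_atom k))) ideal_size.

HB.instance Definition _ := Measure.on ideal_measure_fun.

Let ideal_measure_setT : ideal_measure_fun setT = 1%E.
Proof.
rewrite /ideal_measure_fun /msum.
rewrite (eq_bigr (fun k : 'I__ => ((ideal_weight k)%:R / ideal_total%:R)%:E));
  last by move=> k _; rewrite /= /mscale /= /dirac /= indicE in_setT mule1.
rewrite sumEFin -mulr_suml -natr_sum -/ideal_total divff //.
by rewrite pnatr_eq0 /ideal_total /ideal_size /= big_ord_recl.
Qed.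

HB.instance Definition _ :=
  Measure_isProbability.Build _ _ _ ideal_measure_fun ideal_measure_setT.

Definition ideal_measure : probability S R := ideal_measure_fun.

End IdealMeasure.

Definition lipschitz1 (g : S -> R) : Prop :=
  forall x y : S, `|g x - g y| <= circle_dist x y.

Definition W1 (mu1 mu2 : probability S R) : R :=
  sup [set r | exists2 g : S -> R, lipschitz1 g &
    r = `|\int[mu1]_x g x - \int[mu2]_x g x|].

Definition measure_cms : cms R := CMS W1 ideal_measure.

Definition invariant_measure (T : circle R -> circle R) (mu : probability S R) : Prop :=
  forall A : set S, measurable A -> mu A = mu (T @^-1` A).

End Measures.

Section Construction.
Context (R : realType).

Definition stretch (eps x : R) : R :=
  if x <= eps then eps
  else if x <= 1 - eps then x
  else 2 * x - (1 - eps).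

(* The sequence f is indexed from 0: f i is the (i+1)-st function, which gets
   the weight 2^-((i+1)+1). *)
Definition T_lift (eps : R) (f : nat -> {i01 R} -> {i01 R}) (x : {i01 R}) : R :=
  2^-1 * stretch eps x%:num +
  limn (series (fun i => 2^-1 ^+ i.+2 * (f i x)%:num)).

Definition circle_T (eps : R) (f : nat -> {i01 R} -> {i01 R}) :
    circle R -> circle R :=
  circle_map (T_lift eps f).

Lemma T_lift1 (eps : R) (f : nat -> {i01 R} -> {i01 R}) :
  0 < eps -> eps < 1 ->
  (forall i, f i 0%:i01 = 0%:i01) -> (forall i, f i 1%:i01 = 1%:i01) ->
  T_lift eps f 1%:i01 = 1 + T_lift eps f 0%:i01.
Proof.
move=> eps0 eps1 f0 f1; rewrite /T_lift /stretch /=.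
have -> : (1 <= eps) = false by apply/negbTE; rewrite -ltNge.
have -> : (1 <= 1 - eps) = false by apply/negbTE; rewrite -ltNge; lra.
rewrite (ltW eps0).
have -> : limn (series (fun i => 2^-1 ^+ i.+2 * (f i 0%:i01)%:num)) = 0 :> R.
  rewrite (_ : series _ = fun=> 0) ?lim_cst //.
  by apply/funext => n; rewrite /series /= big1 // => i _; rewrite f0 /= mulr0.
have -> : limn (series (fun i => 2^-1 ^+ i.+2 * (f i 1%:i01)%:num)) = 2^-1 :> R.
  rewrite (_ : series _ = series (geometric (2^-1 ^+ 2) (2^-1 : R))).
    have half1 : `|2^-1 : R| < 1 by rewrite gtr0_norm; lra.
    have /cvg_lim := @cvg_geometric_series R (2^-1 ^+ 2) _ half1.
    by have -> : 1 - 2^-1 = 2^-1 :> R; [lra | rewrite expr2 mulfK //; apply].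
  apply/funext => n; apply: eq_bigr => i _.
  by rewrite f1 /= mulr1 -exprD.
lra.
Qed.

End Construction.

(* Main.v *)
Require Import Defs.
From mathcomp Require Import all_boot all_order all_algebra.
From mathcomp Require Import ring lra.
From mathcomp Require Import all_classical all_reals all_analysis.
From mathcomp Require Import measurable_realfun.

Set Implicit Arguments.
Unset Strict Implicit.
Unset Printing Implicit Defensive.

Import Order.TTheory GRing.Theory Num.Theory.
Import numFieldNormedType.Exports.
Local Open Scope classical_set_scope.

(* Recursive enumerability is handled through the normal form
   "exists k, g <n, k> = 0" with g total recursive, which is closed under
   conjunction, disjunction, existential and bounded universal quantification,
   and which describes the graph of every partial recursive function.

   T is induced by a continuous nondecreasing G : R -> R of degree 1 with
   G x >= x.  By monotonicity a ball is mapped into an open arc as soon as its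
   two endpoints are, and this is semi-decidable because G is approximable at
   rational points; hence T is computable.

   G x = x exactly when x is in K modulo Z.  Cutting the circle at a point of K,
   T maps every arc ]q, k0 + 1] into itself; by invariance the points entering
   the arc form a null set, and letting q run over the rationals shows that an
   invariant measure mu lives on K.  If mu were computable, the positivity of
   the integral of a rational tent function would be semi-decidable, so one
   could search for shrinking intervals of positive measure; their limit would
   be a computable point of K. *)

(** * Recursive functions *)

(** The circle is cut at two different places. Invariance is exploited with the cut at a point [k0]
    of K: since [G] fixes [k0] and [k0 + 1], no point wraps around, and [G x >= x] becomes forward
    invariance of the arcs ending at [k0 + 1]. Effective computations use the cut at 0, where
    representatives of rational points are explicit; tents are forced to vanish there, which costs
    no mass because K avoids 0. Off K, the strict inequality [x < G x] has two sources: in ]0, 1[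
    some [f i] moves the point, while 0, which lies in no ]a i, b i[, is moved by [stretch].

    The distance [W1] suits tents: an ideal measure within 2^-m of [mu] gives the integral of a
    1-Lipschitz function up to 2^-m, and its integral of a rational tent is a computable rational.
    An approximate integral above 2^-m therefore certifies positive mass, and positive mass is
    certified sooner or later. The search for smaller tents never gets stuck, since countably many
    null sets cannot cover a set of positive measure. *)

Definition trec k (f : k.-tuple nat -> nat) : Prop :=
  exists p : recfun k, forall v, reval p v (f v).

Definition trec2 (f : nat -> nat -> nat) : Prop :=
  trec (fun v : 2.-tuple nat => f (thead v) (thead (behead_tuple v))).

Definition trec3 (f : nat -> nat -> nat -> nat) : Prop :=
  trec (fun v : 3.-tuple nat => f (thead v) (thead (behead_tuple v))
    (thead (behead_tuple (behead_tuple v)))).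

(** Every scheme determines its value. For [RFmin], the smaller of two candidate values would give 0
    by its own clause and a successor by the minimality clause of the other. *)
Lemma reval_fun k (p : recfun k) v y y' : reval p v y -> reval p v y' -> y = y'.
Proof.
elim: p v y y' => {k}
  [k|||k m g IHg h IHh|k g IHg h IHh|k g IHg] v y y' /=.
- by move=> -> ->.
- by move=> -> ->.
- by move=> k i -> ->.
- move=> [w [hw gw]] [w' [hw' gw']]; apply: IHg gw _.
  suff -> : w = w' by [].
  by apply: eq_from_tnth => i; apply: IHh (hw i) (hw' i).
- move=> [s [s0 sS ->]] [s' [s'0 s'S ->]].
  suff H n : n <= thead v -> s n = s' n by apply: H.
  elim: n => [_|n IHn ltn]; first exact: IHg s0 s'0.
  have := s'S n ltn; rewrite -(IHn (ltnW ltn)).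
  exact: IHh (sS n ltn).
- move=> [gy gz] [gy' gz']; apply/eqP; rewrite eqn_leq; apply/andP; split.
    rewrite leqNgt; apply/negP => /gz[t ht].
    by have := IHg _ _ _ ht gy'.
  rewrite leqNgt; apply/negP => /gz'[t ht].
  by have := IHg _ _ _ ht gy.
Qed.

Lemma tuple1E (T : Type) (v : 1.-tuple T) : v = [tuple thead v].
Proof. by case/tupleP: v => x t; rewrite (tuple0 t). Qed.

Lemma total_recursiveE f :
  total_recursive f <-> trec (fun v : 1.-tuple nat => f (thead v)).
Proof.
split=> [[p pf]|[p pf]]; exists p; last by move=> n; exact: (pf [tuple n]).
by move=> v; rewrite {1}(tuple1E v); exact: pf.
Qed.

Lemma trec_proj k (i : 'I_k) : trec (fun v : k.-tuple nat => tnth v i).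
Proof. by exists (RFproj i). Qed.

Lemma trec_const k n : trec (fun _ : k.-tuple nat => n).
Proof.
elim: n => [|n [p pn]]; first by exists (RFzero k).
exists (RFcomp RFsucc (fun=> p)) => v /=.
by exists [tuple n]; split => [i|]; [rewrite ord1|].
Qed.

Lemma trec_comp1 k (f : nat -> nat) (g : k.-tuple nat -> nat) :
  total_recursive f -> trec g -> trec (fun v => f (g v)).
Proof.
move=> [p pf] [q qg]; exists (RFcomp p (fun=> q)) => v /=.
by exists [tuple g v]; split => [i|]; [rewrite ord1|apply: pf].
Qed.

Lemma trec_comp2 k f (g h : k.-tuple nat -> nat) :
  trec2 f -> trec g -> trec h -> trec (fun v => f (g v) (h v)).
Proof.
move=> [p pf] [q qg] [r rh].
exists (RFcomp p (fun i : 'I_2 => nth r [:: q] i)) => v /=.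
exists [tuple g v; h v]; split; last exact: (pf [tuple g v; h v]).
by case=> [[|[|//]] lti]; rewrite (tnth_nth 0).
Qed.

Lemma trec2_comp2 f (g h : nat -> nat -> nat) :
  trec2 f -> trec2 g -> trec2 h -> trec2 (fun x y => f (g x y) (h x y)).
Proof. exact: trec_comp2. Qed.

Lemma trec2_comp1 f (g : nat -> nat -> nat) :
  total_recursive f -> trec2 g -> trec2 (fun x y => f (g x y)).
Proof. exact: trec_comp1. Qed.

Lemma trec3_comp2 f (g h : nat -> nat -> nat -> nat) :
  trec2 f -> trec3 g -> trec3 h -> trec3 (fun x y z => f (g x y z) (h x y z)).
Proof. exact: trec_comp2. Qed.

Lemma trec3_comp1 f (g : nat -> nat -> nat -> nat) :
  total_recursive f -> trec3 g -> trec3 (fun x y z => f (g x y z)).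
Proof. exact: trec_comp1. Qed.

Lemma trec2_proj1 : trec2 (fun x _ => x).
Proof. exact: trec_proj ord0. Qed.

Lemma tnth1_thead k (v : k.+2.-tuple nat) (i : 'I_k.+2) :
  i = 1 :> nat -> tnth v i = thead (behead_tuple v).
Proof. by move=> i1; rewrite /thead !(tnth_nth 0) i1 nth_behead. Qed.

Lemma trec2_proj2 : trec2 (fun _ y => y).
Proof.
have [p pE] := @trec_proj 2 (lift ord0 ord0); exists p => v.
by rewrite -(@tnth1_thead 0 v (lift ord0 ord0)).
Qed.

Lemma trec3_proj1 : trec3 (fun x _ _ => x).
Proof. exact: trec_proj ord0. Qed.

Lemma trec3_proj2 : trec3 (fun _ y _ => y).
Proof.
have [p pE] := @trec_proj 3 (lift ord0 ord0); exists p => v.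
by rewrite -(@tnth1_thead 1 v (lift ord0 ord0)).
Qed.

Lemma trec3_proj3 : trec3 (fun _ _ z => z).
Proof.
have [p pE] := @trec_proj 3 ord_max; exists p => v.
have := pE v; rewrite /thead !(tnth_nth 0) /=.
by rewrite !nth_behead.
Qed.

Lemma total_recursive_const n : total_recursive (fun=> n).
Proof. by apply/total_recursiveE; apply: trec_const. Qed.

Lemma total_recursive_id : total_recursive id.
Proof. by apply/total_recursiveE; apply: (trec_proj ord0). Qed.

Lemma total_recursive_succ : total_recursive succn.
Proof. by apply/total_recursiveE; exists RFsucc. Qed.

Lemma trec1_comp2 f g h : trec2 f -> total_recursive g -> total_recursive h ->
  total_recursive (fun x => f (g x) (h x)).
Proof.
by move=> tf /total_recursiveE tg /total_recursiveE th; apply/total_recursiveE;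
  exact: trec_comp2.
Qed.

Lemma total_recursive_comp f g : total_recursive f -> total_recursive g ->
  total_recursive (fun x => f (g x)).
Proof.
by move=> tf /total_recursiveE tg; apply/total_recursiveE; exact: trec_comp1.
Qed.

Definition prec (x : nat) (h : nat -> nat -> nat) (n : nat) : nat :=
  nat_rect (fun=> nat) x h n.

Lemma trec2_prec g h : total_recursive g -> trec3 h ->
  trec2 (fun i n => prec (g n) (fun j s => h j s n) i).
Proof.
move=> [p pg] [q qh]; exists (RFprec p q) => v /=.
exists (prec (g (thead (behead_tuple v)))
  (fun j s => h j s (thead (behead_tuple v)))); split => //.
- by rewrite (tuple1E (behead_tuple v)); exact: pg.
- move=> i _; have := qh (cons_tuple i (cons_tuple
    (prec (g (thead (behead_tuple v))) (fun j s => h j s (thead (behead_tuple v))) i)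
    (behead_tuple v))).
  set w := behead_tuple (behead_tuple _); suff -> : w = behead_tuple v by [].
  exact: val_inj.
Qed.

Lemma total_recursive_min g phi : trec2 g ->
  (forall n, g (phi n) n = 0 /\ forall z, z < phi n -> g z n <> 0) ->
  total_recursive phi.
Proof.
move=> [p pg] phiP; apply/total_recursiveE; exists (RFmin p) => v /=.
have [g0 gn0] := phiP (thead v).
have {}pg z : reval p (cons_tuple z v) (g z (thead v)).
  have := pg (cons_tuple z v); set w := behead_tuple _.
  by have -> : w = v by exact: val_inj.
split=> [|z ltz]; first by have := pg (phi (thead v)); rewrite g0.
exists (g z (thead v)).-1; rewrite prednK //.
by rewrite lt0n; apply/eqP/gn0.
Qed.

Lemma trec2_add : trec2 addn.
Proof.
have := trec2_prec total_recursive_id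
  (trec3_comp1 total_recursive_succ trec3_proj2).
congr (trec2 _); apply/funext => i; apply/funext => n.
by elim: i => //= i ->.
Qed.

Lemma trec2_swap f : trec2 f -> trec2 (fun x y => f y x).
Proof. by move=> tf; exact: trec2_comp2 tf trec2_proj2 trec2_proj1. Qed.

Lemma trec2_mul : trec2 muln.
Proof.
have := trec2_prec (total_recursive_const 0)
  (trec3_comp2 trec2_add trec3_proj3 trec3_proj2).
congr (trec2 _); apply/funext => i; apply/funext => n.
by elim: i => //= i ->; rewrite mulSn.
Qed.

Lemma total_recursive_pred : total_recursive predn.
Proof.
have := trec1_comp2 (trec2_prec (total_recursive_const 0) trec3_proj1)
  total_recursive_id total_recursive_id.
by congr (total_recursive _); apply/funext => -[].
Qed.

Lemma trec2_sub : trec2 subn.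
Proof.
have := trec2_swap (trec2_prec total_recursive_id
  (trec3_comp1 total_recursive_pred trec3_proj2)).
congr (trec2 _); apply/funext => n; apply/funext => i.
by elim: i => /= [|i ->]; rewrite ?subn0 ?subnS.
Qed.

(** Copies the recursion inside [Cantor.to_nat], so that [pair_codeE] holds by conversion. *)
Definition triangular (n : nat) : nat := prec 0 (fun i m => i.+1 + m) n.

Lemma triangularS n : triangular n.+1 = n.+1 + triangular n.
Proof. by []. Qed.

Lemma leq_triangular m n : m <= n -> triangular m <= triangular n.
Proof.
elim: n => [|n IHn]; first by rewrite leqn0 => /eqP ->.
rewrite leq_eqVlt => /orP[/eqP-> //|]; rewrite ltnS => /IHn H.
by rewrite triangularS; apply: leq_trans H (leq_addl _ _).
Qed.

Lemma pair_codeE i j : pair_code i j = j + triangular (j + i).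
Proof. by []. Qed.

Lemma total_recursive_triangular : total_recursive triangular.
Proof.
exact: (trec1_comp2 (trec2_prec (total_recursive_const 0)
  (trec3_comp2 trec2_add (trec3_comp1 total_recursive_succ trec3_proj1)
  trec3_proj2)) total_recursive_id total_recursive_id).
Qed.

Lemma trec2_pair_code : trec2 pair_code.
Proof.
apply: trec2_comp2 trec2_add trec2_proj2 _.
apply: (@trec2_comp1 triangular _ total_recursive_triangular).
exact: trec2_swap trec2_add.
Qed.

(* The diagonal on which n lies is the least w such that n < triangular w.+1. *)
Lemma total_recursive_diagonal :
  total_recursive (fun n => pair_snd n + pair_fst n).
Proof.
apply: (@total_recursive_min (fun w n => n.+1 - triangular w.+1)).
  apply: trec2_comp2 trec2_sub _ _.
    exact: trec2_comp1 total_recursive_succ trec2_proj2.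
  apply: (@trec2_comp1 triangular _ total_recursive_triangular).
  exact: trec2_comp1 total_recursive_succ trec2_proj1.
move=> n; have nE := pair_codeE (pair_fst n) (pair_snd n).
rewrite pair_decodeK in nE; split.
  apply/eqP; rewrite subn_eq0 triangularS {1}nE addSn ltnS leq_add2r.
  exact: leq_addr.
move=> z ltz; apply/eqP; rewrite subn_eq0 -ltnNge ltnS nE.
exact: leq_trans (leq_triangular ltz) (leq_addl _ _).
Qed.

(** A code exceeds the triangular number of its diagonal by its second component; the first
    component is then what remains of the diagonal. *)
Lemma total_recursive_snd : total_recursive pair_snd.
Proof.
have := trec1_comp2 trec2_sub total_recursive_id
  (total_recursive_comp total_recursive_triangular total_recursive_diagonal).
congr (total_recursive _); apply/funext => n /=.
by rewrite -{1}(pair_decodeK n) pair_codeE addnK.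
Qed.

Lemma total_recursive_fst : total_recursive pair_fst.
Proof.
have := trec1_comp2 trec2_sub total_recursive_diagonal total_recursive_snd.
by congr (total_recursive _); apply/funext => n /=; rewrite addKn.
Qed.

(** * Closure rules for unary recursive functions, and coded tuples *)

Lemma pair_fstK i j : pair_fst (pair_code i j) = i.
Proof. by have [] := pair_codeK i j. Qed.

Lemma pair_sndK i j : pair_snd (pair_code i j) = j.
Proof. by have [] := pair_codeK i j. Qed.

Definition pairK := (pair_fstK, pair_sndK).

Lemma rec_const k : total_recursive (fun=> k).
Proof. exact: total_recursive_const. Qed.

Lemma rec_id : total_recursive (fun n => n).
Proof. exact: total_recursive_id. Qed.

Lemma rec_fst f : total_recursive f -> total_recursive (fun n => pair_fst (f n)).
Proof. exact: total_recursive_comp total_recursive_fst. Qed.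

Lemma rec_snd f : total_recursive f -> total_recursive (fun n => pair_snd (f n)).
Proof. exact: total_recursive_comp total_recursive_snd. Qed.

Lemma rec_succ f : total_recursive f -> total_recursive (fun n => (f n).+1).
Proof. exact: total_recursive_comp total_recursive_succ. Qed.

Lemma rec_pred f : total_recursive f -> total_recursive (fun n => (f n).-1).
Proof. exact: total_recursive_comp total_recursive_pred. Qed.

Lemma rec_pair f g : total_recursive f -> total_recursive g ->
  total_recursive (fun n => pair_code (f n) (g n)).
Proof. exact: trec1_comp2 trec2_pair_code. Qed.

Lemma rec_add f g : total_recursive f -> total_recursive g ->
  total_recursive (fun n => f n + g n).
Proof. exact: trec1_comp2 trec2_add. Qed.

Lemma rec_mul f g : total_recursive f -> total_recursive g ->
  total_recursive (fun n => f n * g n).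
Proof. exact: trec1_comp2 trec2_mul. Qed.

Lemma rec_sub f g : total_recursive f -> total_recursive g ->
  total_recursive (fun n => f n - g n).
Proof. exact: trec1_comp2 trec2_sub. Qed.

Lemma rec_app2 (h : nat -> nat -> nat) f g :
  total_recursive (fun m => h (pair_fst m) (pair_snd m)) ->
  total_recursive f -> total_recursive g ->
  total_recursive (fun n => h (f n) (g n)).
Proof.
move=> th tf tg; have := total_recursive_comp th (rec_pair tf tg).
by congr (total_recursive _); apply/funext => n /=; rewrite !pairK.
Qed.

Lemma rec_prec b x (h : nat -> nat -> nat -> nat) :
  total_recursive b -> total_recursive x ->
  total_recursive (fun m =>
    h (pair_fst m) (pair_fst (pair_snd m)) (pair_snd (pair_snd m))) ->
  total_recursive (fun n => prec (x n) (h n) (b n)).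
Proof.
move=> tb tx th; apply: (@trec1_comp2 (fun i n => prec (x n) (h n) i) b id) => //;
  last exact: total_recursive_id.
apply: trec2_prec tx _.
have := trec3_comp1 th (trec3_comp2 trec2_pair_code trec3_proj3
   (trec3_comp2 trec2_pair_code trec3_proj1 trec3_proj2)).
congr (trec3 _); apply/funext => i; apply/funext => s; apply/funext => n.
by rewrite !pairK.
Qed.

Lemma rec_sum b (h : nat -> nat -> nat) : total_recursive b ->
  total_recursive (fun m => h (pair_fst m) (pair_snd m)) ->
  total_recursive (fun n => \sum_(i < b n) h n i).
Proof.
move=> tb th.
have := @rec_prec b (fun=> 0) (fun n i s => s + h n i) tb (rec_const 0) _.
rewrite (_ : (fun n => prec _ _ _) = fun n => \sum_(i < b n) h n i); last first.
  apply/funext => n; elim: (b n) => [|k IHk]; first by rewrite big_ord0.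
  by rewrite big_ord_recr -IHk.
apply; apply: rec_add; first exact: rec_snd (rec_snd rec_id).
exact: rec_app2 th (rec_fst rec_id) (rec_fst (rec_snd rec_id)).
Qed.

Lemma rec_exp2 f : total_recursive f -> total_recursive (fun n => 2 ^ f n).
Proof.
move=> tf; have := @rec_prec f (fun=> 1) (fun _ _ s => 2 * s) tf (rec_const 1) _.
rewrite (_ : (fun n => prec _ _ _) = fun n => 2 ^ f n).
  by apply; apply: rec_mul; [exact: rec_const|exact: rec_snd (rec_snd rec_id)].
by apply/funext => n; elim: (f n) => //= k ->; rewrite expnS.
Qed.

Lemma tuple_decodeS m :
  tuple_decode m.+1 = pair_fst m :: tuple_decode (pair_snd m).
Proof.
by apply: (can_inj tuple_codeK); rewrite tuple_decodeK /= tuple_decodeK pair_decodeK.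
Qed.

(** Nonempty tuples have successor codes, hence the predecessor. The empty tuple, coded by 0, is its
    own tail. *)
Definition tuple_tail (m : nat) : nat := pair_snd m.-1.

Lemma drop_tuple_decode i c :
  drop i (tuple_decode c) = tuple_decode (iter i tuple_tail c).
Proof.
elim: i c => [|i IHi] [|c]; rewrite ?drop0 //.
  by rewrite iterSr (_ : tuple_tail 0 = 0) // -IHi.
by rewrite iterSr tuple_decodeS /= IHi /tuple_tail.
Qed.

Lemma rec_iter_tail f g : total_recursive f -> total_recursive g ->
  total_recursive (fun n => iter (f n) tuple_tail (g n)).
Proof.
move=> tf tg.
have := @rec_prec f g (fun _ _ s => pair_snd s.-1) tf tg _.
rewrite (_ : (fun n => prec _ _ _) = fun n => iter (f n) tuple_tail (g n)).
  by apply; apply: rec_snd (rec_pred (rec_snd (rec_snd rec_id))).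
by apply/funext => n; elim: (f n) => //= k ->.
Qed.

Definition tuple_nth (c i : nat) : nat := nth 0 (tuple_decode c) i.

Lemma rec_tuple_nth f g : total_recursive f -> total_recursive g ->
  total_recursive (fun n => tuple_nth (f n) (g n)).
Proof.
move=> tf tg; have := rec_fst (rec_pred (rec_iter_tail tg tf)).
congr (total_recursive _); apply/funext => n.
rewrite /tuple_nth -[in RHS](addn0 (g n)) -nth_drop drop_tuple_decode.
(* Past the end the code is 0, and [pair_fst 0] agrees with the default value 0 of [nth]. *)
by case: (iter _ _ _) => // m; rewrite tuple_decodeS.
Qed.

Lemma tuple_nth_code (s : nat -> nat) n i : i < n ->
  tuple_nth (tuple_code (mkseq s n)) i = s i.
Proof. by move=> lti; rewrite /tuple_nth tuple_codeK nth_mkseq. Qed.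

Lemma rec_min (h : nat -> nat -> nat) (phi : nat -> nat) :
  total_recursive (fun m => h (pair_fst m) (pair_snd m)) ->
  (forall n, h n (phi n) = 0 /\ forall z, z < phi n -> h n z <> 0) ->
  total_recursive phi.
Proof.
move=> th hP; apply: (@total_recursive_min (fun z n => h n z)) => //.
have := trec2_comp1 th (trec2_swap trec2_pair_code).
congr (trec2 _); apply/funext => z; apply/funext => n.
by rewrite !pairK.
Qed.

(** The size is the least number of tails that leads to 0, the code of the empty tuple; minimization
    finds it. *)
Lemma rec_size f : total_recursive f ->
  total_recursive (fun n => size (tuple_decode (f n))).
Proof.
move=> tf; apply: (@rec_min (fun n i => iter i tuple_tail (f n))).
  exact: rec_iter_tail (rec_snd rec_id) (total_recursive_comp tf (rec_fst rec_id)).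
move=> n; have codeE i : (iter i tuple_tail (f n) = 0) <-> (size (tuple_decode (f n)) <= i).
  have := drop_tuple_decode i (f n); split=> [i0|/drop_oversize d0].
    by move: H; rewrite i0 => /(congr1 size)/eqP; rewrite size_drop subn_eq0.
  by apply: (can_inj tuple_decodeK); rewrite -H d0.
by split=> [|z]; [apply/codeE|rewrite ltnNge => /negP zs /codeE].
Qed.

(** * Semi-decidable predicates *)

Definition sigma1 (P : nat -> Prop) : Prop :=
  exists2 g, total_recursive g & forall n, P n <-> exists k, g (pair_code n k) = 0.

Definition sigma1_2 (P : nat -> nat -> Prop) : Prop :=
  sigma1 (fun m => P (pair_fst m) (pair_snd m)).

Lemma sigma1_ext P Q : (forall n, P n <-> Q n) -> sigma1 P -> sigma1 Q.
Proof. by move=> PQ [g tg gP]; exists g => // n; rewrite -PQ. Qed.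

Lemma sigma1_eq0 g : total_recursive g -> sigma1 (fun n => g n = 0).
Proof.
move=> tg; exists (fun m => g (pair_fst m)).
  exact: total_recursive_comp tg (rec_fst rec_id).
move=> n; split=> [g0|[k]]; last by rewrite pair_fstK.
by exists 0; rewrite pair_fstK.
Qed.

Lemma sigma1_leq f g : total_recursive f -> total_recursive g ->
  sigma1 (fun n => f n <= g n).
Proof.
move=> tf tg; apply: sigma1_ext (sigma1_eq0 (rec_sub tf tg)) => n.
by rewrite -subn_eq0; split => /eqP.
Qed.

Lemma sigma1_ltn f g : total_recursive f -> total_recursive g ->
  sigma1 (fun n => f n < g n).
Proof. by move=> tf tg; exact: sigma1_leq (rec_succ tf) tg. Qed.

Lemma sigma1_comp P f : sigma1 P -> total_recursive f -> sigma1 (fun n => P (f n)).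
Proof.
move=> [g tg gP] tf; exists (fun m => g (pair_code (f (pair_fst m)) (pair_snd m))).
  apply: total_recursive_comp tg (rec_pair _ (rec_snd rec_id)).
  exact: total_recursive_comp tf (rec_fst rec_id).
by move=> n; rewrite gP; split=> -[k gk]; exists k; move: gk; rewrite !pairK.
Qed.

Lemma sigma1_ex P : sigma1_2 P -> sigma1 (fun n => exists k, P n k).
Proof.
move=> [g tg gP]; exists (fun m => g (pair_code
    (pair_code (pair_fst m) (pair_fst (pair_snd m))) (pair_snd (pair_snd m)))).
  apply: total_recursive_comp tg (rec_pair (rec_pair (rec_fst rec_id) _) _).
    exact: rec_fst (rec_snd rec_id).
  exact: rec_snd (rec_snd rec_id).
move=> n; split=> [[k Pnk]|[m]].
  have := (gP (pair_code n k)).1; rewrite !pairK => /(_ Pnk)[w gw].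
  by exists (pair_code k w); rewrite !pairK.
rewrite !pairK => g0; exists (pair_fst m).
have := (gP (pair_code n (pair_fst m))).2; rewrite !pairK.
by apply; exists (pair_snd m).
Qed.

(** A sum of naturals vanishes only if both terms do, and the two witnesses are paired. For
    disjunction, a product with one common witness is enough. *)
Lemma sigma1_and P Q : sigma1 P -> sigma1 Q -> sigma1 (fun n => P n /\ Q n).
Proof.
move=> [g tg gP] [h th hQ].
pose k m := g (pair_code (pair_fst m) (pair_fst (pair_snd m))) +
  h (pair_code (pair_fst m) (pair_snd (pair_snd m))).
exists k.
  apply: rec_add.
    apply: total_recursive_comp tg (rec_pair (rec_fst rec_id) _).
    exact: rec_fst (rec_snd rec_id).
  apply: total_recursive_comp th (rec_pair (rec_fst rec_id) _).
  exact: rec_snd (rec_snd rec_id).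
move=> n; rewrite gP hQ; split=> [[[x gx] [y hy]]|[m]].
  by exists (pair_code x y); rewrite /k !pairK gx hy.
rewrite /k !pairK => /eqP; rewrite addn_eq0 => /andP[/eqP g0 /eqP h0].
by split; eexists; eassumption.
Qed.

Lemma sigma1_or P Q : sigma1 P -> sigma1 Q -> sigma1 (fun n => P n \/ Q n).
Proof.
move=> [g tg gP] [h th hQ]; exists (fun m => g m * h m); first exact: rec_mul.
move=> n; rewrite gP hQ; split=> [[[x gx]|[x hx]]|[m]].
- by exists x; rewrite gx.
- by exists x; rewrite hx muln0.
- by move=> /eqP; rewrite muln_eq0 => /orP[] /eqP ?; [left|right]; exists m.
Qed.

(** Not uniform in [P]: by excluded middle, one of the constant functions 0 and 1 does the job. *)
Lemma sigma1_const (P : Prop) : sigma1 (fun=> P).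
Proof.
have [p|np] := pselect P.
  by apply: sigma1_ext (sigma1_eq0 (rec_const 0)) => n; split.
by apply: sigma1_ext (sigma1_eq0 (rec_const 1)) => n; split.
Qed.

Lemma sigma1_eq f g : total_recursive f -> total_recursive g ->
  sigma1 (fun n => f n = g n).
Proof.
move=> tf tg.
apply: sigma1_ext (sigma1_and (sigma1_leq tf tg) (sigma1_leq tg tf)) => n.
by split=> [[fg gf]|->//]; apply/eqP; rewrite eqn_leq fg gf.
Qed.

(* Witnesses for all z < b n are collected in a single coded tuple. *)
Lemma sigma1_forall_lt b P : total_recursive b -> sigma1_2 P ->
  sigma1 (fun n => forall z, z < b n -> P n z).
Proof.
move=> tb [g tg gP].
pose h n c z := g (pair_code (pair_code n z) (tuple_nth c z)).
exists (fun m => \sum_(z < b (pair_fst m)) h (pair_fst m) (pair_snd m) z).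
  apply: (@rec_sum (fun m => b (pair_fst m)) (fun m => h (pair_fst m) (pair_snd m))).
    exact: total_recursive_comp tb (rec_fst rec_id).
  apply: total_recursive_comp tg (rec_pair (rec_pair _ _) (rec_tuple_nth _ _));
    do ?[exact: rec_id | apply: rec_fst | apply: rec_snd].
move=> n; have {}gP z : P n z <-> exists k, g (pair_code (pair_code n z) k) = 0.
  by have := gP (pair_code n z); rewrite !pairK.
split=> [Pn|[c]].
  have /choice[w wP] : forall z, exists k, z < b n -> g (pair_code (pair_code n z) k) = 0.
    move=> z; have [/Pn/gP[k gk]|_] := ltnP z (b n); last by exists 0.
    by exists k.
  exists (tuple_code (mkseq w (b n))); rewrite !pairK big1 // => z _.
  by rewrite /h tuple_nth_code // wP.
rewrite !pairK => /eqP; rewrite sum_nat_eq0 => /forallP s0 z ltz.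
by apply/gP; exists (tuple_nth c z); have /implyP/(_ isT)/eqP := s0 (Ordinal ltz).
Qed.

(** Effective choice. The least [k] with [P n k] need not be computable, so the least code of a pair
    (value, witness) is sought instead, and its first component returned. *)
Lemma sigma1_select P : sigma1_2 P -> (forall n, exists k, P n k) ->
  exists2 phi, total_recursive phi & forall n, P n (phi n).
Proof.
move=> [g tg gP] Pex.
pose h n m := g (pair_code (pair_code n (pair_fst m)) (pair_snd m)).
have hex n : exists m, h n m == 0.
  have [k Pnk] := Pex n; have := (gP (pair_code n k)).1.
  rewrite !pairK => /(_ Pnk)[w gw].
  by exists (pair_code k w); rewrite /h !pairK gw.
have tmin : total_recursive (fun n => ex_minn (hex n)).
  apply: (@rec_min h).
    by apply: total_recursive_comp tg (rec_pair (rec_pair _ _) _);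
      do ?[exact: rec_id | apply: rec_fst | apply: rec_snd].
  move=> n; case: ex_minnP => m /eqP hm minm; split => // z.
  by rewrite ltnNge => /negP mz /eqP/minm.
exists (fun n => pair_fst (ex_minn (hex n))); first exact: rec_fst.
move=> n; case: ex_minnP => m /eqP hm _.
have := (gP (pair_code n (pair_fst m))).2; rewrite !pairK.
by apply; exists (pair_snd m).
Qed.

Lemma sigma1_forall_ord k P : (forall i : 'I_k, sigma1 (P i)) ->
  sigma1 (fun n => forall i : 'I_k, P i n).
Proof.
elim: k P => [|k IHk] P sP.
  by apply: sigma1_ext (sigma1_const True) => n; split=> // _ [].
have sPk := IHk _ (fun i => sP (lift ord0 i)).
apply: sigma1_ext (sigma1_and (sP ord0) sPk) => n; split=> [[P0 PS] i|Pn].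
  by have [j ->|->] := unliftP ord0 i.
by split.
Qed.

(** The existential data in [reval] (intermediate values, successive values of a recursion) are
    finite, hence coded by one number. Arguments and value are recursive functions of [n] so that
    the induction hypotheses apply to decoded data. *)
Lemma sigma1_reval k (p : recfun k) (v : nat -> k.-tuple nat) (y : nat -> nat) :
  (forall i, total_recursive (fun n => tnth (v n) i)) -> total_recursive y ->
  sigma1 (fun n => reval p (v n) (y n)).
Proof.
elim: p v y => {k}
  [k||k i|k m g IHg h IHh|k g IHg h IHh|k g IHg] v y tv ty /=.
- exact: sigma1_eq0.
- exact: sigma1_eq ty (rec_succ (tv ord0)).
- exact: sigma1_eq.
- pose w c : m.-tuple nat := [tuple tuple_nth c i | i < m].
  apply: (@sigma1_ext (fun n => exists c,
      (forall i, reval (h i) (v n) (tnth (w c) i)) /\ reval g (w c) (y n))).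
    move=> n; split=> [[c cP]|[t tP]]; first by exists (w c).
    suff tE : t = w (tuple_code t) by exists (tuple_code t); rewrite -tE.
    apply: eq_from_tnth => i; rewrite tnth_mktuple /tuple_nth tuple_codeK.
    by rewrite (tnth_nth 0).
  have tw i : total_recursive (fun c => tnth (w (pair_snd c)) i).
    have := rec_tuple_nth (rec_snd rec_id) (rec_const i).
    by congr (total_recursive _); apply/funext => c; rewrite tnth_mktuple.
  apply: sigma1_ex; apply: sigma1_and.
    apply: sigma1_forall_ord => i; apply: IHh => // j.
    exact: total_recursive_comp (tv j) (rec_fst rec_id).
  by apply: IHg => //; exact: total_recursive_comp ty (rec_fst rec_id).
- pose s := tuple_nth.
  apply: (@sigma1_ext (fun n => exists c,
      [/\ reval g (behead_tuple (v n)) (s c 0),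
      forall i, i < thead (v n) -> reval h (cons_tuple i
        (cons_tuple (s c i) (behead_tuple (v n)))) (s c i.+1)
      & y n = s c (thead (v n))])).
    move=> n; split=> [[c cP]|[t [t0 tS ->]]]; first by exists (s c).
    (* Only the values of [t] at 0, ..., [thead (v n)] are constrained, whence this length. *)
    exists (tuple_code (mkseq t (thead (v n)).+1)).
    split=> [|i lti|]; rewrite /s ?tuple_nth_code ?ltnS //; last exact: ltnW.
    exact: tS.
  have tb i : total_recursive (fun n => tnth (behead_tuple (v n)) i).
    have := tv (lift ord0 i); congr (total_recursive _); apply/funext => n.
    by rewrite !(tnth_nth 0) nth_behead.
  have tvh := tv ord0.
  apply: sigma1_ex.
  apply: (@sigma1_ext (fun m => reval g (behead_tuple (v (pair_fst m))) (s (pair_snd m) 0) /\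
     ((forall i, i < thead (v (pair_fst m)) -> reval h (cons_tuple i
        (cons_tuple (s (pair_snd m) i) (behead_tuple (v (pair_fst m))))) (s (pair_snd m) i.+1))
      /\ y (pair_fst m) = s (pair_snd m) (thead (v (pair_fst m)))))).
    by move=> m; split=> [[? []]|[]].
  apply: sigma1_and; last apply: sigma1_and.
  + apply: IHg => [i|]; last exact: rec_tuple_nth (rec_snd rec_id) (rec_const 0).
    exact: total_recursive_comp (tb i) (rec_fst rec_id).
  + apply: sigma1_forall_lt.
      exact: total_recursive_comp tvh (rec_fst rec_id).
    apply: IHh => [i|]; last first.
      apply: rec_tuple_nth; first exact: rec_snd (rec_fst rec_id).
      exact: rec_succ (rec_snd rec_id).
    have [j ->|->] := unliftP ord0 i; last exact: rec_snd rec_id.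
    under eq_fun do rewrite tnthS.
    have [l ->|->] := unliftP ord0 j; last first.
      by apply: rec_tuple_nth; [exact: rec_snd (rec_fst rec_id)|exact: rec_snd rec_id].
    under eq_fun do rewrite tnthS.
    exact: total_recursive_comp (tb l) (rec_fst (rec_fst rec_id)).
  + apply: sigma1_eq; first exact: total_recursive_comp ty (rec_fst rec_id).
    apply: rec_tuple_nth (rec_snd rec_id) _.
    exact: total_recursive_comp tvh (rec_fst rec_id).
- have cons_rec (q : nat -> nat) (r : nat -> nat) i : total_recursive q -> total_recursive r ->
      total_recursive (fun n => tnth (cons_tuple (q n) (v (r n))) i).
    move=> tq tr; have [j ->|-> //] := unliftP ord0 i.
    under eq_fun do rewrite tnthS.
    exact: total_recursive_comp (tv j) tr.
  apply: sigma1_and.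
    by apply: IHg => [i|]; [exact: (@cons_rec y id) rec_id|exact: rec_const].
  apply: sigma1_forall_lt => //; apply: sigma1_ex; apply: IHg.
    by move=> i; apply: cons_rec; do ?[exact: rec_id|apply: rec_fst|apply: rec_snd].
  exact: rec_succ (rec_snd rec_id).
Qed.

Lemma sigma1_re E : recursively_enumerable E <-> sigma1 E.
Proof.
split=> [[p ->]|[g tg gE]].
  apply: sigma1_ex; apply: sigma1_reval => [i|]; last exact: rec_fst rec_id.
  by rewrite ord1; exact: rec_snd rec_id.
have /total_recursiveE := tg => -[q qg].
have /total_recursiveE := rec_fst rec_id => -[pf pfE].
have [pa paE] := @trec2_add.
(* The minimized function ignores the search variable: [pm] has value 0 where [g] vanishes and is
   undefined elsewhere. *)
pose pm := RFmin (RFcomp q (fun=> RFproj (lift ord0 (ord0 : 'I_1)))).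
have pmE x z : reval pm [tuple x] z <-> z = 0 /\ g x = 0.
  have qE (t : 1.-tuple nat) u : reval q t u <-> u = g (thead t).
    by split=> [/reval_fun/(_ (qg t))|->].
  have pE (u : nat) (t : 1.-tuple nat) : thead t = x ->
      forall i, reval (RFproj (lift ord0 (ord0 : 'I_1)))
         (cons_tuple u [tuple x]) (tnth t i).
    by move=> tx i; rewrite [i]ord1 /= !(tnth_nth 0) /= -tx /thead (tnth_nth 0).
  split=> /= [[[t [tx /qE gt]] zP]|[-> gx]].
    have txE : thead t = x by rewrite /thead tx (tnth_nth 0).
    rewrite txE in gt; split=> //; case: z tx zP => // z tx /(_ 0 isT)[u [t' [t'x /qE]]].
    by rewrite {1}/thead t'x (tnth_nth 0) /= -gt.
  by split=> //; exists [tuple x]; split; [exact: pE|apply/qE].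
(* The partial function [pair_fst x + pm x]: adding 0 changes no value but restricts the domain to
   the zeros of [g], so its range is [E]. *)
exists (RFcomp pa (fun i : 'I_2 => nth pm [:: pf] i)).
apply/seteqP; split=> y /=; rewrite /eval1 /=.
  rewrite gE => -[k gk]; exists (pair_code y k) => /=.
  exists [tuple y; 0]; split; last by have := paE [tuple y; 0]; rewrite addn0.
  case=> [[|[|//]] lti]; rewrite (tnth_nth 0); last exact/pmE.
  by have := pfE [tuple pair_code y k]; rewrite /= pair_fstK.
move=> [x [w [wP]]] /reval_fun/(_ (paE w)) ->; rewrite gE.
have := wP (Ordinal (isT : 1 < 2)); rewrite (tnth_nth 0) => /pmE[w1 gx].
have := wP (Ordinal (isT : 0 < 2)); rewrite (tnth_nth 0) => /reval_fun/(_ (pfE _)) w0.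
exists (pair_snd x); rewrite /thead !(tnth_nth 0) nth_behead w0 w1 addn0.
by rewrite /= pair_decodeK.
Qed.

Ltac rec := repeat first
  [ assumption | exact: rec_id | exact: rec_const | apply: rec_fst | apply: rec_snd
  | apply: rec_succ | apply: rec_pred | apply: rec_pair | apply: rec_add
  | apply: rec_mul | apply: rec_sub | apply: rec_exp2 | apply: rec_tuple_nth ].

(** * Recursive sequences of rational numbers *)

Local Open Scope ring_scope.

Section RationalSequences.
Context {R : realType}.
Implicit Types r s t : nat -> R.

(** Real-valued, yet given by indices of rationals: order relations between such sequences become
    relations between naturals, hence decidable. *)
Definition qrec r : Prop :=
  exists2 phi, total_recursive phi & forall n, r n = any_rational (phi n).

Definition rational_code (a b c : nat) : nat := pair_code (pair_code a b) c.

Lemma any_rational_code a b c :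
  any_rational (rational_code a b c) = (a%:R - b%:R) / c.+1%:R :> R.
Proof. by rewrite /any_rational !pairK. Qed.

Lemma qrec_quot f g h : total_recursive f -> total_recursive g ->
  total_recursive h -> qrec (fun n => ((f n)%:R - (g n)%:R) / (h n).+1%:R).
Proof.
move=> tf tg th; exists (fun n => rational_code (f n) (g n) (h n)).
  by rewrite /rational_code; rec.
by move=> n; rewrite any_rational_code.
Qed.

Lemma qrec_ext r s : r =1 s -> qrec r -> qrec s.
Proof. by move=> /funext ->. Qed.

Lemma qrec_split r : qrec r -> exists f g h, [/\ total_recursive f,
  total_recursive g, total_recursive h &
  forall n, r n = ((f n)%:R - (g n)%:R) / (h n).+1%:R].
Proof.
move=> [phi tphi rE]; exists (fun n => pair_fst (pair_fst (phi n))),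
  (fun n => pair_snd (pair_fst (phi n))), (fun n => pair_snd (phi n)).
by split=> //; rec.
Qed.

Lemma qrec_any f : total_recursive f -> qrec (fun n => any_rational (f n)).
Proof. by move=> tf; exists f. Qed.

Lemma qrec_nat f : total_recursive f -> qrec (fun n => (f n)%:R).
Proof.
move=> tf; apply: qrec_ext (qrec_quot tf (rec_const 0) (rec_const 0)) => n.
by rewrite subr0 divr1.
Qed.

Lemma qrec_const k : qrec (fun=> any_rational k).
Proof. by apply: qrec_any; rec. Qed.

Lemma qrec_natc k : qrec (fun=> k%:R).
Proof. by apply: qrec_nat; rec. Qed.

Lemma qrec_1 : qrec (fun=> 1).
Proof. exact: (qrec_natc 1). Qed.

Lemma qrec_0 : qrec (fun=> 0).
Proof. exact: (qrec_natc 0). Qed.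

Lemma qrec_inv f : total_recursive f -> qrec (fun n => (f n).+1%:R^-1).
Proof.
move=> tf; apply: qrec_ext (qrec_quot (rec_const 1) (rec_const 0) tf) => n.
by rewrite subr0 div1r.
Qed.

Lemma qrec_exp f : total_recursive f -> qrec (fun n => 2^-1 ^+ f n).
Proof.
move=> tf; have := qrec_inv (rec_pred (rec_exp2 tf)).
by apply: qrec_ext => n; rewrite prednK ?expn_gt0 // natrX exprVn.
Qed.

(** Addition on codes, so that sums with a variable number of terms are obtained by primitive
    recursion. Denominators are stored minus one, hence the final predecessor. *)
Definition rational_add (i j : nat) : nat := rational_code
  (pair_fst (pair_fst i) * (pair_snd j).+1 + pair_fst (pair_fst j) * (pair_snd i).+1)
  (pair_snd (pair_fst i) * (pair_snd j).+1 + pair_snd (pair_fst j) * (pair_snd i).+1)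
  ((pair_snd i).+1 * (pair_snd j).+1).-1.

Lemma rec_rational_add f g : total_recursive f -> total_recursive g ->
  total_recursive (fun n => rational_add (f n) (g n)).
Proof. by move=> tf tg; rewrite /rational_add /rational_code; rec. Qed.

Lemma rational_addE i j :
  any_rational (rational_add i j) = any_rational i + any_rational j :> R.
Proof.
rewrite any_rational_code prednK ?muln_gt0 // !natrD !natrM.
rewrite /any_rational; set a := _%:R; set b := _%:R; set c := _%:R.
by field; rewrite !nat1r !pnatr_eq0.
Qed.

Lemma qrec_add r s : qrec r -> qrec s -> qrec (fun n => r n + s n).
Proof.
move=> [f tf rE] [g tg sE]; exists (fun n => rational_add (f n) (g n)).
  exact: rec_rational_add.
by move=> n; rewrite rational_addE rE sE.
Qed.

Lemma qrec_opp r : qrec r -> qrec (fun n => - r n).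
Proof.
move=> /qrec_split[f [g [h [tf tg th rE]]]].
by apply: qrec_ext (qrec_quot tg tf th) => n; rewrite rE -mulNr opprB.
Qed.

Lemma qrec_sub r s : qrec r -> qrec s -> qrec (fun n => r n - s n).
Proof. by move=> qr qs; exact: qrec_add qr (qrec_opp qs). Qed.

Lemma qrec_mul r s : qrec r -> qrec s -> qrec (fun n => r n * s n).
Proof.
move=> /qrec_split[f [g [h [tf tg th rE]]]] /qrec_split[f' [g' [h' [tf' tg' th' sE]]]].
have := @qrec_quot (fun n => f n * f' n + g n * g' n)%N
  (fun n => f n * g' n + g n * f' n)%N (fun n => ((h n).+1 * (h' n).+1).-1)%N.
move=> q; apply: qrec_ext (q _ _ _); try by rec.
move=> n; rewrite rE sE prednK ?muln_gt0 // !natrD !natrM.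
by field; rewrite !nat1r !pnatr_eq0.
Qed.

Lemma qrec_comp r f : qrec r -> total_recursive f -> qrec (fun n => r (f n)).
Proof.
move=> [phi tphi rE] tf; exists (fun n => phi (f n)) => //.
exact: total_recursive_comp tphi tf.
Qed.

Lemma qrec_app2 (r : nat -> nat -> R) f g :
  qrec (fun m => r (pair_fst m) (pair_snd m)) ->
  total_recursive f -> total_recursive g -> qrec (fun n => r (f n) (g n)).
Proof.
by move=> qr tf tg; apply: qrec_ext (qrec_comp qr (rec_pair tf tg)) => n; rewrite !pairK.
Qed.

(** Cross-multiplication, with the subtracted parts moved across so that the comparison takes place
    in [nat] without truncated subtraction. *)
Lemma ltr_quot (f g h f' g' h' : nat) :
  ((f%:R - g%:R) / h.+1%:R < (f'%:R - g'%:R) / h'.+1%:R :> R) =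
  (f * h'.+1 + g' * h.+1 < f' * h.+1 + g * h'.+1)%N.
Proof.
rewrite ltr_pdivrMr ?ltr0n // mulrAC ltr_pdivlMr ?ltr0n // !mulrBl.
by rewrite ltrBlDr addrAC ltrBrDr -!natrM -!natrD ltr_nat.
Qed.

Lemma sigma1_ltr r s : qrec r -> qrec s -> sigma1 (fun n => r n < s n).
Proof.
move=> /qrec_split[f [g [h [tf tg th rE]]]] /qrec_split[f' [g' [h' [tf' tg' th' sE]]]].
apply: sigma1_ext (sigma1_ltn (rec_add (rec_mul tf (rec_succ th')) (rec_mul tg' (rec_succ th)))
   (rec_add (rec_mul tf' (rec_succ th)) (rec_mul tg (rec_succ th')))) => n.
by rewrite rE sE ltr_quot.
Qed.

Lemma sigma1_ler r s : qrec r -> qrec s -> sigma1 (fun n => r n <= s n).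
Proof.
move=> /qrec_split[f [g [h [tf tg th rE]]]] /qrec_split[f' [g' [h' [tf' tg' th' sE]]]].
apply: sigma1_ext (sigma1_leq (rec_add (rec_mul tf (rec_succ th')) (rec_mul tg' (rec_succ th)))
   (rec_add (rec_mul tf' (rec_succ th)) (rec_mul tg (rec_succ th')))) => n.
by rewrite rE sE leNgt ltr_quot -leqNgt.
Qed.

Lemma sigma1_eqr r s : qrec r -> qrec s -> sigma1 (fun n => r n = s n).
Proof.
move=> qr qs.
apply: sigma1_ext (sigma1_and (sigma1_ler qr qs) (sigma1_ler qs qr)) => n.
by split=> [[rs sr]|->//]; apply/eqP; rewrite eq_le rs.
Qed.

(** A code of the right value is found by [sigma1_select]: both branches are semi-decidable and one
    of them always applies. *)
Lemma qrec_if r s u v : qrec r -> qrec s -> qrec u -> qrec v ->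
  qrec (fun n => if r n <= s n then u n else v n).
Proof.
move=> qr qs qu qv.
have [||phi tphi phiP] := @sigma1_select (fun n k =>
    r n <= s n /\ any_rational k = u n \/ s n < r n /\ any_rational k = v n).
- apply: sigma1_or; apply: sigma1_and.
  + by apply: sigma1_ler; apply: qrec_comp => //; rec.
  + apply: sigma1_eqr; first by apply: qrec_any; rec.
    by apply: qrec_comp => //; rec.
  + by apply: sigma1_ltr; apply: qrec_comp => //; rec.
  + apply: sigma1_eqr; first by apply: qrec_any; rec.
    by apply: qrec_comp => //; rec.
- move=> n; case: qu => f _ uE; case: qv => g _ vE.
  have [rs|sr] := leP (r n) (s n).
    by exists (f n); left; rewrite uE.
  by exists (g n); right; rewrite vE.
- exists phi => // n; have := phiP n.
  by have [rs|sr] := leP (r n) (s n) => -[[]|[]].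
Qed.

Lemma qrec_min r s : qrec r -> qrec s -> qrec (fun n => Num.min (r n) (s n)).
Proof.
move=> qr qs; apply: qrec_ext (qrec_if qr qs qr qs) => n.
by rewrite minElt; case: ltgtP.
Qed.

Lemma qrec_max r s : qrec r -> qrec s -> qrec (fun n => Num.max (r n) (s n)).
Proof.
move=> qr qs; apply: qrec_ext (qrec_if qr qs qs qr) => n.
by rewrite maxElt; case: ltgtP.
Qed.

Lemma qrec_norm r : qrec r -> qrec (fun n => `|r n|).
Proof.
move=> qr; apply: qrec_ext (qrec_if qrec_0 qr qr (qrec_opp qr)) => n.
by case: ger0P.
Qed.

Lemma qrec_sum b (r : nat -> nat -> R) : total_recursive b ->
  qrec (fun m => r (pair_fst m) (pair_snd m)) ->
  qrec (fun n => \sum_(i < b n) r n i).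
Proof.
move=> tb [phi tphi rE].
exists (fun n => prec 0 (fun i c => rational_add c (phi (pair_code n i))) (b n)).
  apply: (@rec_prec b (fun=> 0%N)
    (fun n i c => rational_add c (phi (pair_code n i)))) => //; first by rec.
  by apply: rec_rational_add; rec; apply: total_recursive_comp tphi _; rec.
move=> n; elim: (b n) => [|k IHk].
  by rewrite big_ord0 /any_rational /= subrr mul0r.
rewrite big_ord_recr /= rational_addE IHk; congr (_ + _).
by rewrite -rE !pairK.
Qed.

Lemma qrec_nneg f : total_recursive f -> qrec (fun n => nneg_rational (f n)).
Proof.
move=> tf; apply: qrec_ext (qrec_quot (rec_fst tf) (rec_const 0) (rec_snd tf)) => n.
by rewrite subr0.
Qed.

Lemma qrec_pos f : total_recursive f -> qrec (fun n => pos_rational (f n)).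
Proof.
move=> tf.
apply: qrec_ext (qrec_quot (rec_succ (rec_fst tf)) (rec_const 0) (rec_snd tf)) => n.
by rewrite subr0.
Qed.

Lemma any_rational_ratr (q : rat) : exists i, any_rational i = ratr q :> R.
Proof.
rewrite -(divq_num_den q) fmorph_div /= !ratr_int.
have := denq_gt0 q; case: (denq q) => // -[//|d] _.
case: (numq q) => [n|n].
  by exists (rational_code n 0 d); rewrite any_rational_code subr0.
by exists (rational_code 0 n.+1 d); rewrite any_rational_code sub0r NegzE mulrNz.
Qed.

Lemma any_rational_dense (x y : R) : x < y -> exists i, x < any_rational i < y.
Proof.
move=> xy; have [q qP] := rat_in_itvoo xy.
by have [i iE] := any_rational_ratr q; exists i; rewrite iE.
Qed.

Lemma nneg_rationalE (i : nat) : 0 <= any_rational i :> R ->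
  exists j, nneg_rational j = any_rational i :> R.
Proof.
rewrite /any_rational; set a := pair_fst _; set b := pair_snd _; set c := pair_snd _.
rewrite pmulr_lge0 ?invr_gt0 ?ltr0n // subr_ge0 ler_nat => ba.
by exists (pair_code (a - b) c); rewrite /nneg_rational !pairK natrB.
Qed.

Lemma pos_rationalE (i : nat) : 0 < any_rational i :> R ->
  exists j, pos_rational j = any_rational i :> R.
Proof.
rewrite /any_rational; set a := pair_fst _; set b := pair_snd _; set c := pair_snd _.
rewrite pmulr_lgt0 ?invr_gt0 ?ltr0n // subr_gt0 ltr_nat => ba.
exists (pair_code (a - b).-1 c); rewrite /pos_rational !pairK prednK ?subn_gt0 //.
by rewrite natrB // ltnW.
Qed.

Lemma exp_half_gt0 n : 0 < 2^-1 ^+ n :> R.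
Proof. by rewrite exprn_gt0 // invr_gt0. Qed.

Lemma exp_half_small (x : R) : 0 < x -> exists n, 2^-1 ^+ n < x.
Proof.
move=> x0; exists (Num.truncn x^-1).+1;
rewrite exprVn -[ltRHS]invrK ltf_pV2 ?posrE ?invr_gt0 ?exprn_gt0 //.
apply: lt_trans (truncnS_gt _) _.
by rewrite -natrX ltr_nat ltn_expl.
Qed.

End RationalSequences.

(** * Distance and representatives on the circle *)

Section CircleDistance.
Context {R : realType}.

Lemma circle_dist_ltP (x y r : R) :
  circle_dist (to_circle x) (to_circle y) < r <->
  exists m : int, `|x - y - m%:~R| < r.
Proof.
rewrite /circle_dist; set D := [set _ | _]; split=> [Dr|[m mr]].
  have D0 : D !=set0 by exists `|x - y|, x, y.
  have [_ [x' [y' [/to_circle_eq/intrP[m xm] /to_circle_eq/intrP[k yk] ->]]] xyr] :=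
    inf_lt D0 Dr.
  exists (k - m); rewrite intrB -xm -yk; congr (`|_| < r): xyr; lra.
apply: le_lt_trans mr; apply: ge_inf; first by exists 0 => _ [? [? [_ _ ->]]].
exists x, (y + m%:~R); split=> //; last by congr `|_|; lra.
by apply/to_circle_eq; rewrite addrAC subrr add0r intr_int.
Qed.

Lemma frac_ge0 (x : R) : 0 <= x - (Num.floor x)%:~R.
Proof. by rewrite subr_ge0 floor_le. Qed.

Lemma frac_lt1 (x : R) : x - (Num.floor x)%:~R < 1.
Proof. by rewrite ltrBlDl -[1]/(1%:~R) -intrD floorD1_gt. Qed.

Definition unit_frac (x : R) : {i01 R} := Itv01 (frac_ge0 x) (ltW (frac_lt1 x)).

Lemma unit_fracE (x : R) : (unit_frac x)%:num = x - (Num.floor x)%:~R.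
Proof. by []. Qed.

Lemma to_circle_unit_frac (x : R) : to_circle (unit_frac x)%:num = to_circle x.
Proof. by apply/to_circle_eq; rewrite unit_fracE addrAC subrr add0r rpredN intr_int. Qed.

(** The value [t = 1] is allowed, so that an integer also belongs to the unit interval on its left,
    as [line_lift_left] requires. *)
Lemma int_unit_decomp (m : int) (x : R) : m%:~R <= x <= m%:~R + 1 ->
  exists t : {i01 R}, x = m%:~R + t%:num.
Proof.
move=> mx; have t0 : 0 <= x - m%:~R by lra.
have t1 : x - m%:~R <= 1 by lra.
by exists (Itv01 t0 t1) => /=; lra.
Qed.

End CircleDistance.

(** * The lift of T to the real line *)

Section Lift.
Context {R : realType}.
Variables (eps : R) (f : nat -> {i01 R} -> {i01 R}).
Hypothesis eps_bounds : 0 < eps <= 2^-1.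
Hypothesis f_nondecreasing : forall i (x y : {i01 R}),
  x%:num <= y%:num -> (f i x)%:num <= (f i y)%:num.
Hypothesis f_ge : forall i (x : {i01 R}), x%:num <= (f i x)%:num.
Hypothesis f1 : forall i, f i 1%:i01 = 1%:i01.
Hypothesis f0 : forall i, f i 0%:i01 = 0%:i01.
Hypothesis f_continuous : forall i (x : {i01 R}) (d : R), 0 < d ->
  exists2 h : R, 0 < h & forall y : {i01 R}, `|y%:num - x%:num| < h ->
    `|(f i y)%:num - (f i x)%:num| < d.

Definition lift_sum (N : nat) (x : {i01 R}) : R :=
  2^-1 * stretch eps x%:num + \sum_(i < N) 2^-1 ^+ i.+2 * (f i x)%:num.

Local Notation F := (T_lift eps f).

Lemma sum_exp_half N : \sum_(i < N) (2^-1 : R) ^+ i.+2 = 2^-1 - 2^-1 ^+ N.+1.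
Proof.
elim: N => [|N IHN]; first by rewrite big_ord0 expr1 subrr.
by rewrite big_ord_recr /= IHN !exprS; set u := _ ^+ N; lra.
Qed.

Lemma lift_sumS N (x : {i01 R}) :
  lift_sum N.+1 x = lift_sum N x + 2^-1 ^+ N.+2 * (f N x)%:num.
Proof. by rewrite /lift_sum big_ord_recr addrA. Qed.

Lemma lift_sumD M N (x : {i01 R}) : (N <= M)%N ->
  lift_sum N x <= lift_sum M x <= lift_sum N x + (2^-1 ^+ N.+1 - 2^-1 ^+ M.+1).
Proof.
move=> /subnK <-; elim: (M - N)%N => [|k /andP[IH1 IH2]].
  by rewrite add0n subrr addr0 lexx.
rewrite addSn lift_sumS.
have t0 : 0 <= (2^-1 : R) ^+ (k + N).+2 by rewrite exprn_ge0 // invr_ge0.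
have fx0 : 0 <= (f (k + N) x)%:num :> R by [].
have fx1 : (f (k + N) x)%:num <= 1 :> R by [].
have p0 : 0 <= (2^-1 : R) ^+ (k + N).+2 * (f (k + N) x)%:num by rewrite mulr_ge0.
have p1 : (2^-1 : R) ^+ (k + N).+2 * (f (k + N) x)%:num <= 2^-1 ^+ (k + N).+2.
  by rewrite ler_piMr.
apply/andP; split; first by lra.
have tE : (2^-1 : R) ^+ (k + N).+1 = 2 * 2^-1 ^+ (k + N).+2 by rewrite [in RHS]exprS; lra.
by rewrite tE in IH2; lra.
Qed.

(** The partial sums increase, and the tail is at most geometric because the [f i] take values in
    [0, 1]. Monotonicity, continuity and approximability of the limit all rest on these two
    bounds. *)
Lemma T_lift_bounds N x : lift_sum N x <= F x <= lift_sum N x + 2^-1 ^+ N.+1.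
Proof.
pose u := series (fun i => 2^-1 ^+ i.+2 * (f i x)%:num).
have uE M : lift_sum M x = 2^-1 * stretch eps x%:num + u M.
  by rewrite /lift_sum /u /series /= big_mkord.
have u_nd : nondecreasing_seq u.
  by move=> M M' /(lift_sumD x); rewrite !uE lerD2l => /andP[].
have u_ub M : u M <= u N + 2^-1 ^+ N.+1.
  have e0 k : 0 <= (2^-1 : R) ^+ k by rewrite exprn_ge0 // invr_ge0.
  have [/(lift_sumD x)/andP[_]|/ltnW/(lift_sumD x)/andP[H _]] := leqP N M.
    by rewrite !uE; have := e0 M.+1; lra.
  by rewrite !uE in H; have := e0 N.+1; lra.
have u_cvg : cvgn u.
  apply: nondecreasing_is_cvgn => //; exists (u N + 2^-1 ^+ N.+1).
  by move=> _ [M _ <-].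
rewrite /T_lift -/u uE; apply/andP; split.
  by rewrite lerD2l; exact: nondecreasing_cvgn_le.
rewrite -addrA lerD2l; apply: limr_le => //.
by near=> M; exact: u_ub.
Unshelve. all: by end_near. Qed.

Lemma stretch_nondecreasing (x y : R) : x <= y -> stretch eps x <= stretch eps y.
Proof.
move: eps_bounds; rewrite /stretch => /andP[e0 e1] xy.
by case: (leP x eps) (leP x (1 - eps)) (leP y eps) (leP y (1 - eps)) =>
  ? [] ? [] ? [] ?; lra.
Qed.

Lemma stretch_ge (x : R) : x <= 1 -> x <= stretch eps x.
Proof.
move: eps_bounds; rewrite /stretch => /andP[e0 e1] x1.
by case: (leP x eps) (leP x (1 - eps)) => ? [] ?; lra.
Qed.

Lemma ler_exp_half (x y : R) : (forall N, x <= y + 2^-1 ^+ N) -> x <= y.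
Proof.
move=> xyN; rewrite leNgt; apply/negP => yx.
have [|N] := @exp_half_small R (x - y); first by rewrite subr_gt0.
by have := xyN N; lra.
Qed.

Lemma T_lift_nondecreasing (x y : {i01 R}) : x%:num <= y%:num -> F x <= F y.
Proof.
move=> xy; apply: ler_exp_half => N.
have /andP[_ Fx] := T_lift_bounds N x; have /andP[Fy _] := T_lift_bounds N y.
have : lift_sum N x <= lift_sum N y.
  apply: lerD; first by rewrite ler_wpM2l ?invr_ge0 ?stretch_nondecreasing.
  apply: ler_sum => i _; rewrite ler_wpM2l ?exprn_ge0 ?invr_ge0 //.
  exact: f_nondecreasing.
have := @exp_half_gt0 R N; move: Fx; rewrite exprS; lra.
Qed.

(* Terms other than the given ones are estimated by f i x >= x. *)
Lemma T_lift_gap N (x : {i01 R}) (i : 'I_N) :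
  2^-1 * stretch eps x%:num + 2^-1 * x%:num +
    2^-1 ^+ i.+2 * ((f i x)%:num - x%:num) <= F x.
Proof.
(* The first [L] terms include [i], and their weights fall short of 1/2 by [2^-(L+1)], at most
   [2^-M]. *)
apply: ler_exp_half => M; pose L := (N + M)%N.
have /andP[Fx _] := T_lift_bounds L x; apply: le_trans (lerD Fx (lexx _)).
have iL : (i < L)%N by apply: leq_trans (ltn_ord i) (leq_addr _ _).
have term0 (j : 'I_L) : 0 <= 2^-1 ^+ j.+2 * ((f j x)%:num - x%:num) :> R.
  by rewrite mulr_ge0 ?exprn_ge0 ?invr_ge0 // subr_ge0.
have : 2^-1 ^+ i.+2 * ((f i x)%:num - x%:num) <=
    \sum_(j < L) 2^-1 ^+ j.+2 * ((f j x)%:num - x%:num) :> R.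
  rewrite (bigD1 (Ordinal iL)) //= lerDl; apply: sumr_ge0 => j _; exact: term0.
under eq_bigr do rewrite mulrBr; rewrite sumrB -mulr_suml sum_exp_half /lift_sum.
have e0 k : 0 < (2^-1 : R) ^+ k by exact: exp_half_gt0.
have x1 : (2^-1 : R) ^+ L.+1 * x%:num <= 2^-1 ^+ L.+1 by rewrite ler_piMr ?(ltW (e0 _)).
have x0 : 0 <= x%:num :> R by [].
have LM : (2^-1 : R) ^+ L.+1 <= 2^-1 ^+ M.
  by rewrite ler_wiXn2l ?invr_ge0 ?invf_le1 ?ler1n //; exact/leqW/leq_addl.
lra.
Qed.

Lemma T_lift_ge (x : {i01 R}) : x%:num <= F x.
Proof.
have := @T_lift_gap 1 x ord0; have := @stretch_ge x%:num.
have : 0 <= 2^-1 ^+ 2 * ((f 0%N x)%:num - x%:num) :> R.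
  by rewrite mulr_ge0 ?exprn_ge0 ?invr_ge0 // subr_ge0.
have x1 : x%:num <= 1 :> R by [].
by move=> H0 /(_ x1) H1 H2; rewrite /= in H2; lra.
Qed.

(** Partial sums are continuous and approximate the limit uniformly; half of [d] is spent on
    each. *)
Lemma T_lift_continuous (x : {i01 R}) (d : R) : 0 < d ->
  exists2 h : R, 0 < h & forall y : {i01 R}, `|y%:num - x%:num| < h ->
    `|F y - F x| < d.
Proof.
move=> d0.
(* The slopes of [stretch] are at most 2, so with its weight 1/2 it is 1-Lipschitz. *)
have stretch_lip (u v : R) : `|stretch eps u - stretch eps v| <= 2 * `|u - v|.
  move: eps_bounds; rewrite /stretch => /andP[e0 e1].
  by case: (ger0P (u - v)) => uv;
    case: (leP u eps) (leP u (1 - eps)) (leP v eps) (leP v (1 - eps)) =>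
      ? [] ? [] ? [] ?; rewrite ler_norml; apply/andP; split; lra.
have sum_cont N e : 0 < e -> exists2 h : R, 0 < h & forall y : {i01 R},
    `|y%:num - x%:num| < h -> `|lift_sum N y - lift_sum N x| < e.
  elim: N e => [|N IHN] e e0.
    exists e => // y yx; rewrite /lift_sum !big_ord0 !addr0 -mulrBr normrM.
    by rewrite ger0_norm ?invr_ge0 //; have := stretch_lip y%:num x%:num; lra.
  have [|h1 h10 h1P] := IHN (e / 2); first by lra.
  have [|h2 h20 h2P] := @f_continuous N x (e / 2); first by lra.
  exists (Num.min h1 h2); first by rewrite lt_min h10.
  move=> y; rewrite lt_min => /andP[/h1P yh1 /h2P yh2].
  rewrite !lift_sumS opprD addrACA -mulrBr.
  have t0 : 0 <= (2^-1 : R) ^+ N.+2 by rewrite exprn_ge0 // invr_ge0.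
  have t1 : (2^-1 : R) ^+ N.+2 <= 1 by rewrite exprn_ile1 ?invr_ge0 // invf_le1 ?ler1n.
  apply: le_lt_trans (ler_normD _ _) _; rewrite normrM ger0_norm //.
  have : 2^-1 ^+ N.+2 * `|(f N y)%:num - (f N x)%:num| <= 1 * `|(f N y)%:num - (f N x)%:num|.
    by rewrite ler_wpM2r.
  by lra.
have [|N Nd] := @exp_half_small R (d / 2); first by lra.
have [|h h0 hP] := sum_cont N (d / 2); first by lra.
exists h => // y /hP; have := T_lift_bounds N x; have := T_lift_bounds N y.
rewrite exprS.
move=> /andP[y1 y2] /andP[x1 x2]; rewrite !ltr_norml => /andP[l1 l2].
by apply/andP; split; lra.
Qed.

Definition line_lift (x : R) : R := F (unit_frac x) + (Num.floor x)%:~R.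

Local Notation G := line_lift.

Lemma T_lift_1 : F 1%:i01 = 1 + F 0%:i01.
Proof. by apply: T_lift1 => //; case/andP: eps_bounds => e0 e1; lra. Qed.

(** Also covers [t = 1], where the floor jumps and [T_lift_1] compensates; this is how continuity of
    [G] passes across integers. *)
Lemma line_lift_unit (m : int) (t : {i01 R}) : G (m%:~R + t%:num) = F t + m%:~R.
Proof.
have t0 : 0 <= t%:num :> R by []. have : t%:num <= 1 :> R by [].
rewrite /line_lift le_eqVlt => /orP[/eqP t1|t1].
  have fl : Num.floor (m%:~R + t%:num) = m + 1 :> int.
    by apply: floor_def; rewrite t1 !intrD lexx /=; lra.
  have -> : unit_frac (m%:~R + t%:num) = 0%:i01.
    by apply/val_inj; rewrite /= fl t1 intrD subrr.
  have -> : F t = F 1%:i01 by congr F; exact/val_inj.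
  by rewrite fl T_lift_1 intrD; lra.
have fl : Num.floor (m%:~R + t%:num) = m :> int.
  by apply: floor_def; rewrite intrD; lra.
rewrite fl; congr (F _ + _); apply/val_inj; rewrite /= fl; lra.
Qed.

Lemma line_liftDz (x : R) (m : int) : G (x + m%:~R) = G x + m%:~R.
Proof.
rewrite (_ : x + m%:~R = (m + Num.floor x)%:~R + (unit_frac x)%:num).
  by rewrite line_lift_unit /line_lift intrD; lra.
by rewrite unit_fracE intrD; lra.
Qed.

Lemma line_lift_nondecreasing (x y : R) : x <= y -> G x <= G y.
Proof.
move=> xy; rewrite /line_lift.
have := le_floor xy; rewrite le_eqVlt => /orP[/eqP E|].
  rewrite E lerD2r; apply: T_lift_nondecreasing; rewrite !unit_fracE E; lra.
rewrite -lezD1 -(ler_int R) intrD => xy1.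
have Fx : F (unit_frac x) <= F 1%:i01.
  by apply: T_lift_nondecreasing => /=; exact/ltW/frac_lt1.
have Fy : F 0%:i01 <= F (unit_frac y).
  by apply: T_lift_nondecreasing => /=; exact: frac_ge0.
by rewrite T_lift_1 in Fx; lra.
Qed.

Lemma line_lift_ge (x : R) : x <= G x.
Proof. by have := T_lift_ge (unit_frac x); rewrite unit_fracE /line_lift; lra. Qed.

Lemma line_lift_right (x w : R) : G x < w -> exists2 y, x < y & G y < w.
Proof.
set m := Num.floor x; set t := unit_frac x => Gw.
have xE : x = m%:~R + t%:num by rewrite unit_fracE /m; lra.
rewrite xE line_lift_unit in Gw.
have [|h h0 hP] := @T_lift_continuous t (w - (F t + m%:~R)); first by lra.
have t0 : 0 <= t%:num :> R by []. have t1 : t%:num < 1 by exact: frac_lt1.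
pose e := Num.min h (1 - t%:num) / 2.
have [e0 eh et] : [/\ 0 < e, e < h & e < 1 - t%:num].
  by rewrite /e; case: (leP h (1 - t%:num)) => ?; split; lra.
have [|s sE] := @int_unit_decomp _ m (x + e); first by lra.
exists (x + e); first by lra.
rewrite sE line_lift_unit; have := hP s.
rewrite (_ : s%:num - t%:num = e); last by lra.
by rewrite gtr0_norm // => /(_ eh); rewrite ltr_norml; lra.
Qed.

Lemma line_lift_left (x w : R) : w < G x -> exists2 y, y < x & w < G y.
Proof.
(* The ceiling of [x] minus one: then [t] lies in ]0, 1], leaving room on the left inside the same
   unit interval. *)
pose m := - Num.floor (- x) - 1.
have mE : m%:~R = - (Num.floor (- x))%:~R - 1 :> R by rewrite /m intrB intrN.
have fx := floor_le (- x); have := floorD1_gt (- x); rewrite intrD => fx1.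
have [|t xE] := @int_unit_decomp _ m x; first by lra.
rewrite {1}xE line_lift_unit => Gw.
have [|h h0 hP] := @T_lift_continuous t (F t + m%:~R - w); first by lra.
have t1 : t%:num <= 1 :> R by []. have t0 : 0 < t%:num by lra.
pose e := Num.min h t%:num / 2.
have [e0 eh et] : [/\ 0 < e, e < h & e < t%:num].
  by rewrite /e; case: (leP h t%:num) => ?; split; lra.
have [|s sE] := @int_unit_decomp _ m (x - e); first by lra.
exists (x - e); first by lra.
rewrite sE line_lift_unit; have := hP s.
rewrite (_ : s%:num - t%:num = - e); last by lra.
by rewrite normrN gtr0_norm // => /(_ eh); rewrite ltr_norml; lra.
Qed.

Lemma circle_T_to_circle (x : R) : circle_T eps f (to_circle x) = to_circle (G x).
Proof.
rewrite -to_circle_unit_frac /circle_T circle_map_to_circle; last exact: T_lift_1.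
apply/to_circle_eq; rewrite /line_lift opprD addrA subrr add0r rpredN.
exact: intr_int.
Qed.

Lemma line_lift_near (x d : R) : 0 < d -> exists u v,
  [/\ u < x, x < v & forall y, u <= y <= v -> `|G y - G x| < d].
Proof.
move=> d0; have [|u ux Gu] := @line_lift_left x (G x - d); first by lra.
have [|v xv Gv] := @line_lift_right x (G x + d); first by lra.
exists u, v; split=> // y /andP[/line_lift_nondecreasing uy /line_lift_nondecreasing yv].
by rewrite ltr_norml; lra.
Qed.

End Lift.

(** * Computability of T *)

Section ComputableMap.
Context {R : realType}.

Definition unit_ideal (e : nat) : {i01 R} := cms_ideal (unit_cms R) e.

Lemma unit_idealE e : (unit_ideal e)%:num = Num.min 1 (nneg_rational e) :> R.
Proof. by []. Qed.

Lemma qrec_unit_ideal e : total_recursive e -> qrec (fun n => (unit_ideal (e n))%:num).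
Proof. by move=> te; exact: qrec_min qrec_1 (qrec_nneg te). Qed.

Lemma unit_ideal_dense (v : {i01 R}) (d : R) : 0 < d ->
  exists j, `|(unit_ideal j)%:num - v%:num| < d.
Proof.
move=> d0; have [|i /andP[vi id]] := @any_rational_dense R v%:num (v%:num + d).
  by lra.
have v0 : 0 <= v%:num :> R by [].
have v1 : v%:num <= 1 :> R by [].
have [|j jE] := @nneg_rationalE R i; first by lra.
exists j; rewrite unit_idealE jE ltr_norml.
by case: (leP 1 (any_rational i)) => ?; lra.
Qed.

Definition half_index (n : nat) : nat := pair_code 0 (2 ^ n).-1.

Lemma half_indexE n : pos_rational (half_index n) = 2^-1 ^+ n :> R.
Proof.
rewrite /pos_rational !pairK prednK ?expn_gt0 // div1r natrX exprVn //.
Qed.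

Lemma rec_half_index f : total_recursive f ->
  total_recursive (fun n => half_index (f n)).
Proof. by move=> tf; rewrite /half_index; rec. Qed.

Variable f : nat -> {i01 R} -> {i01 R}.
Hypothesis f_computable : uniformly_computable (unit_cms R) (unit_cms R) f.

Lemma f_preimage : exists2 E : nat -> nat -> nat -> Prop,
  sigma1 (fun m => E (pair_fst m) (pair_fst (pair_snd m)) (pair_snd (pair_snd m))) &
  forall i n x, ideal_ball (unit_cms R) n (f i x) <->
    exists2 d, E i n d & `|(unit_ideal (pair_fst d))%:num - x%:num| <
                         pos_rational (pair_snd d).
Proof.
have [E /sigma1_re sE EP] := f_computable.
exists (fun i n => E (pair_code i n)).
  apply: sigma1_ext (sigma1_comp sE (rec_pair (rec_pair (rec_fst rec_id)
    (rec_fst (rec_snd rec_id))) (rec_snd (rec_snd rec_id)))) => m.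
  by rewrite /mkset !pairK.
move=> i n x; have := EP (pair_code i n); rewrite !pairK => /seteqP[fE Ef].
by split=> [/fE|/Ef].
Qed.

(** A small ideal ball around [f i x] has a preimage that is a union of balls; [h] is the room left
    around [x] in one of them. *)
Lemma computable_continuous i (x : {i01 R}) (d : R) : 0 < d ->
  exists2 h : R, 0 < h & forall y : {i01 R}, `|y%:num - x%:num| < h ->
    `|(f i y)%:num - (f i x)%:num| < d.
Proof.
move=> d0; have [|n nd] := @exp_half_small R (d / 2); first by lra.
have [E _ EP] := f_preimage.
have [j jd] := unit_ideal_dense (f i x) (@exp_half_gt0 R n).
have ballE y : ideal_ball (unit_cms R) (pair_code j (half_index n)) y <->
    `|(unit_ideal j)%:num - y%:num| < 2^-1 ^+ n.
  by rewrite /ideal_ball /= !pairK half_indexE.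
have /EP[e Ee xe] := (ballE _).2 jd.
exists (pos_rational (pair_snd e) - `|(unit_ideal (pair_fst e))%:num - x%:num|).
  by rewrite subr_gt0.
move=> y yx; have /ballE : ideal_ball (unit_cms R) (pair_code j (half_index n)) (f i y).
  apply/EP; exists e => //; apply: le_lt_trans (ler_distD x%:num _ _) _.
  by rewrite (distrC x%:num); lra.
move: jd; rewrite !ltr_norml => /andP[? ?] /andP[? ?].
by apply/andP; split; lra.
Qed.

(** Membership of [f i (unit_ideal e)] in a ball of radius [2^-k] is semi-decidable through
    preimages, and density guarantees that the search for a centre ends. *)
Lemma f_approx : exists2 al : nat -> nat -> nat -> nat,
  total_recursive (fun m => al (pair_fst m) (pair_fst (pair_snd m)) (pair_snd (pair_snd m))) &
  forall i e k, `|(unit_ideal (al i e k))%:num - (f i (unit_ideal e))%:num| < 2^-1 ^+ k.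
Proof.
have [E sE EP] := f_preimage.
pose P m j := ideal_ball (unit_cms R) (pair_code j (half_index (pair_snd (pair_snd m))))
  (f (pair_fst m) (unit_ideal (pair_fst (pair_snd m)))).
have [||al tal alP] := @sigma1_select P.
- rewrite /P; apply: sigma1_ext => [m|]; first by rewrite EP exists2E; exact: iff_refl.
  apply: sigma1_ex; apply: sigma1_and.
    pose g m := pair_code (pair_fst (pair_fst (pair_fst m))) (pair_code (pair_code
      (pair_snd (pair_fst m)) (half_index (pair_snd (pair_snd (pair_fst (pair_fst m)))))) (pair_snd m)).
    have tg : total_recursive g by rewrite /g; rec; apply: rec_half_index; rec.
    by apply: sigma1_ext (sigma1_comp sE tg) => m; rewrite /g !pairK.
  apply: sigma1_ltr; last by apply: qrec_pos; rec.
  by apply: qrec_norm; apply: qrec_sub; apply: qrec_unit_ideal; rec.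
- move=> n; have [j jd] := unit_ideal_dense (f (pair_fst n) (unit_ideal (pair_fst (pair_snd n))))
    (@exp_half_gt0 R (pair_snd (pair_snd n))).
  by exists j; rewrite /P /ideal_ball /= !pairK half_indexE.
exists (fun i e k => al (pair_code i (pair_code e k))).
  by apply: total_recursive_comp tal _; rec.
move=> i e k; have := alP (pair_code i (pair_code e k)).
by rewrite /P /ideal_ball /= !pairK half_indexE.
Qed.

Variable eps : rat.
Hypothesis eps_bounds : 0 < (ratr eps : R) <= 2^-1.
Local Notation F := (T_lift (ratr eps) f).

(** Truncating at [N] terms costs [2^-(N+1)]; replacing each [f i] by a [2^-N]-approximation costs
    no more, since the weights sum to less than 1/2. *)
Lemma T_lift_approx : exists2 A : nat -> nat -> R,
  qrec (fun m => A (pair_fst m) (pair_snd m)) &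
  forall e N, `|F (unit_ideal e) - A e N| <= 2^-1 ^+ N.
Proof.
have [al tal alP] := f_approx.
exists (fun e N => 2^-1 * stretch (ratr eps) (unit_ideal e)%:num +
    \sum_(i < N) 2^-1 ^+ i.+2 * (unit_ideal (al i e N))%:num).
  have [ei eiE] := @any_rational_ratr R eps.
  have qeps : qrec (fun=> ratr eps : R) by rewrite -eiE; exact: qrec_const.
  have qu : qrec (fun m => (unit_ideal (pair_fst m))%:num) by apply: qrec_unit_ideal; rec.
  apply: qrec_add.
    apply: qrec_mul; first exact: qrec_inv (rec_const 1).
    apply: qrec_if => //; apply: qrec_if => //; first exact: qrec_sub qrec_1 qeps.
    apply: qrec_sub; last exact: qrec_sub qrec_1 qeps.
    exact: qrec_mul (qrec_natc 2) qu.
  apply: (@qrec_sum _ pair_snd (fun m i =>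
    2^-1 ^+ i.+2 * (unit_ideal (al i (pair_fst m) (pair_snd m)))%:num)); first by rec.
  apply: qrec_mul; first by apply: qrec_exp; rec.
  apply: qrec_unit_ideal.
  pose g m := pair_code (pair_snd m) (pair_fst m).
  have tg : total_recursive g by rewrite /g; rec.
  have := total_recursive_comp tal tg.
  by congr total_recursive; apply/funext => m; rewrite /g !pairK.
move=> e N; have /andP[F1 F2] := T_lift_bounds (ratr eps) f N (unit_ideal e).
set A := (X in _ - X).
have PA : `|lift_sum (ratr eps) f N (unit_ideal e) - A| <= 2^-1 ^+ N.+1.
  rewrite /lift_sum /A opprD addrACA subrr add0r -sumrB; apply: le_trans (ler_norm_sum _ _ _) _.
  apply: (@le_trans _ _ (\sum_(i < N) 2^-1 ^+ i.+2 * 2^-1 ^+ N)).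
    apply: ler_sum => i _; rewrite -mulrBr normrM ger0_norm ?exprn_ge0 ?invr_ge0 //.
    rewrite ler_wpM2l ?exprn_ge0 ?invr_ge0 // distrC ltW //.
  rewrite -mulr_suml sum_exp_half exprS ler_wpM2r ?exprn_ge0 ?invr_ge0 //.
  by have := exp_half_gt0 N.+1 (R := R); rewrite exprS; lra.
move: PA; rewrite !ler_norml => /andP[A1 A2]; move: F2 A1 A2; rewrite exprS => F2 A1 A2.
by apply/andP; split; lra.
Qed.

Lemma sigma1_T_lift_gt e (w : nat -> R) : total_recursive e -> qrec w ->
  sigma1 (fun n => w n < F (unit_ideal (e n))).
Proof.
move=> te qw; have [A qA AP] := T_lift_approx.
apply: (@sigma1_ext (fun n => exists N, w n < A (e n) N - 2^-1 ^+ N)).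
  move=> n; split=> [[N]|wF].
    by have := AP (e n) N; rewrite ler_norml; lra.
  have [|N] := @exp_half_small R ((F (unit_ideal (e n)) - w n) / 2); first by lra.
  by exists N; have := AP (e n) N; rewrite ler_norml; lra.
apply: sigma1_ex; apply: sigma1_ltr; first by apply: qrec_comp qw _; rec.
apply: qrec_sub; last by apply: qrec_exp; rec.
apply: qrec_app2 qA _ _; last by rec.
by apply: total_recursive_comp te _; rec.
Qed.

Lemma sigma1_T_lift_lt e (w : nat -> R) : total_recursive e -> qrec w ->
  sigma1 (fun n => F (unit_ideal (e n)) < w n).
Proof.
move=> te qw; have [A qA AP] := T_lift_approx.
apply: (@sigma1_ext (fun n => exists N, A (e n) N + 2^-1 ^+ N < w n)).
  move=> n; split=> [[N]|wF].
    by have := AP (e n) N; rewrite ler_norml; lra.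
  have [|N] := @exp_half_small R ((w n - F (unit_ideal (e n))) / 2); first by lra.
  by exists N; have := AP (e n) N; rewrite ler_norml; lra.
apply: sigma1_ex; apply: sigma1_ltr; last by apply: qrec_comp qw _; rec.
apply: qrec_add; last by apply: qrec_exp; rec.
apply: qrec_app2 qA _ _; last by rec.
by apply: total_recursive_comp te _; rec.
Qed.

Hypothesis f_nondecreasing : forall i (x y : {i01 R}),
  x%:num <= y%:num -> (f i x)%:num <= (f i y)%:num.
Hypothesis f1 : forall i, f i 1%:i01 = 1%:i01.
Hypothesis f0 : forall i, f i 0%:i01 = 0%:i01.

Local Notation G := (line_lift (ratr eps) f).

Lemma int_natB (m : int) : exists a b : nat, m%:~R = a%:R - b%:R :> R.
Proof.
case: m => n; first by exists n, 0%N; rewrite subr0.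
by exists 0%N, n.+1; rewrite NegzE mulrNz sub0r.
Qed.

(** Reduces [G] at a rational to [F] at an ideal point of [0, 1], the only place where [F] is
    approximated. The integer part is a difference of naturals because codes hold naturals. *)
Lemma unit_ideal_decomp (i : nat) : exists e a b : nat,
  any_rational i = (unit_ideal e)%:num + (a%:R - b%:R) :> R.
Proof.
pose x : R := any_rational i.
have [a [b abE]] := int_natB (Num.floor x).
have [j jE] : exists j, any_rational j = x - (a%:R - b%:R) :> R.
  have [phi _ /(_ 0%N) ->] : qrec (fun=> x - (a%:R - b%:R)).
    by apply: qrec_sub (qrec_const i) (qrec_sub (qrec_natc a) (qrec_natc b)).
  by exists (phi 0%N).
have fx0 := frac_ge0 x; have fx1 := frac_lt1 x.
have [|e eE] := @nneg_rationalE R j; first by rewrite jE -abE.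
exists e, a, b; rewrite unit_idealE eE jE -abE.
by rewrite (min_idPr (ltW fx1)) subrK.
Qed.

Lemma computable_circle_T :
  computable_function (circle_cms R) (circle_cms R) (circle_T (ratr eps) f).
Proof.
have contf := computable_continuous.
have G_mono := line_lift_nondecreasing eps_bounds f_nondecreasing f1 f0.
have G_near := line_lift_near eps_bounds f_nondecreasing f1 f0 contf.
have G_unit := line_lift_unit eps_bounds f1 f0.
(* Slots of [t]: ideal points at 0 and 3; integers, as differences of two naturals, at 1-2, 4-5 and
   6-7. *)
pose z (t i : nat) : R := (tuple_nth t i)%:R - (tuple_nth t i.+1)%:R.
pose u t i : {i01 R} := unit_ideal (tuple_nth t i).
pose c m : R := nneg_rational (pair_fst m).
pose r m : R := pos_rational (pair_snd m).
(* The source ball e is mapped into the target ball n because the endpoints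
   c e -+ r e of a lift of e are mapped by the monotone G into a lift of n;
   t lists the decompositions of the endpoints and the shift of the lift of n. *)
pose E n e := exists t,
  [/\ c e - r e = (u t 0%N)%:num + z t 1%N, c e + r e = (u t 3)%:num + z t 4,
    c n + z t 6 - r n < F (u t 0%N) + z t 1%N &
    F (u t 3) + z t 4 < c n + z t 6 + r n].
exists (fun n => [set e | E n e]).
  apply/sigma1_re; rewrite /mkset /E.
  apply: sigma1_ex.
  have qz i : qrec (fun m => z (pair_snd m) i).
    by apply: qrec_sub; apply: qrec_nat; rec.
  have qu i : qrec (fun m => (u (pair_snd m) i)%:num).
    by apply: qrec_unit_ideal; rec.
  have qce : qrec (fun m => c (pair_snd (pair_fst m))) by apply: qrec_nneg; rec.
  have qcn : qrec (fun m => c (pair_fst (pair_fst m))) by apply: qrec_nneg; rec.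
  have qre : qrec (fun m => r (pair_snd (pair_fst m))) by apply: qrec_pos; rec.
  have qrn : qrec (fun m => r (pair_fst (pair_fst m))) by apply: qrec_pos; rec.
  (* The integer shifts are moved to the rational side, leaving [F] alone as the comparison lemmas
     require. *)
  pose P m := c (pair_snd (pair_fst m)) - r (pair_snd (pair_fst m)) =
      (u (pair_snd m) 0%N)%:num + z (pair_snd m) 1%N /\
    (c (pair_snd (pair_fst m)) + r (pair_snd (pair_fst m)) =
      (u (pair_snd m) 3)%:num + z (pair_snd m) 4 /\
    (c (pair_fst (pair_fst m)) + z (pair_snd m) 6 - r (pair_fst (pair_fst m)) -
      z (pair_snd m) 1%N < F (u (pair_snd m) 0%N) /\
    F (u (pair_snd m) 3) < c (pair_fst (pair_fst m)) + z (pair_snd m) 6 +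
      r (pair_fst (pair_fst m)) - z (pair_snd m) 4)).
  apply: (@sigma1_ext P).
    by move=> m; rewrite /P !(ltrBlDr, ltrBrDr); split=> [[? [? []]]|[]].
  apply: sigma1_and; last apply: sigma1_and; last apply: sigma1_and.
  - by apply: sigma1_eqr; [apply: qrec_sub|apply: qrec_add].
  - by apply: sigma1_eqr; [apply: qrec_add|apply: qrec_add].
  - apply: sigma1_T_lift_gt; first by rec.
    by apply: qrec_sub => //; apply: qrec_sub => //; apply: qrec_add.
  - apply: sigma1_T_lift_lt; first by rec.
    by apply: qrec_sub => //; apply: qrec_add => //; apply: qrec_add.
have GE t i : G ((u t i)%:num + z t i.+1) = F (u t i) + z t i.+1.
  have /intrP[m mE] : z t i.+1 \is a Num.int by rewrite rpredB ?natr_int.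
  by rewrite mE addrC G_unit.
have intz t i : exists m : int, z t i = m%:~R.
  by apply/intrP; rewrite rpredB ?natr_int.
have distE (x : R) n : ideal_ball (circle_cms R) n (to_circle x) <->
    exists m : int, `|c n - x - m%:~R| < r n.
  exact: circle_dist_ltP.
move=> n; apply/seteqP; split=> s; rewrite -(to_circle_frac s); set x := circle_frac s.
  rewrite /= circle_T_to_circle // => /distE[m xm].
  (* [d] is half the slack: values within [d] of [G x] stay in the same lift of the target ball. *)
  have [d d0 dm] : exists2 d, 0 < d & `|c n - G x - m%:~R| + d < r n.
    exists ((r n - `|c n - G x - m%:~R|) / 2); lra.
  have {}dm : - (r n - d) < c n - G x - m%:~R < r n - d by rewrite -ltr_norml; lra.
  have [u0 [v0 [u0x xv0 uvP]]] := G_near x d d0.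
  have x0 : 0 <= x by exact: circle_frac_ge0.
  (* The centre i lies between x and x + h, and the radius exceeds its distance
     to x by less than what is left. *)
  pose h := Num.min (v0 - x) (x - u0) / 3.
  have [h0 hv hu] : [/\ 0 < h, x + 2 * h < v0 & u0 < x - 2 * h].
    by rewrite /h; case: (leP (v0 - x) (x - u0)) => ?; split; lra.
  have [|i /andP[xi ih]] := @any_rational_dense R x (x + h); first by lra.
  have [|j /andP[hj jh]] := @any_rational_dense R h (2 * h - (any_rational i - x)).
    by lra.
  have [ci ciE] := @nneg_rationalE R i (ltac:(lra)).
  have [rj rjE] := @pos_rationalE R j (ltac:(lra)).
  have [k1 k1E] : exists k, any_rational k = any_rational i - any_rational j :> R.
    have [phi _ /(_ 0%N) ->] := @qrec_sub R _ _ (qrec_const i) (qrec_const j).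
    by exists (phi 0%N).
  have [k2 k2E] : exists k, any_rational k = any_rational i + any_rational j :> R.
    have [phi _ /(_ 0%N) ->] := @qrec_add R _ _ (qrec_const i) (qrec_const j).
    by exists (phi 0%N).
  have [e1 [a1 [b1 E1]]] := unit_ideal_decomp k1.
  have [e2 [a2 [b2 E2]]] := unit_ideal_decomp k2.
  have [a3 [b3 E3]] := int_natB (- m).
  exists (pair_code ci rj); last first.
    rewrite /ideal_ball /= !pairK; apply/circle_dist_ltP; exists 0.
    by rewrite ciE rjE subr0 ltr_norml; lra.
  exists (tuple_code [:: e1; a1; b1; e2; a2; b2; a3; b3]).
  set t := tuple_code _.
  have uE0 : u t 0%N = unit_ideal e1 by rewrite /u /tuple_nth tuple_codeK.
  have uE3 : u t 3 = unit_ideal e2 by rewrite /u /tuple_nth tuple_codeK.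
  have zE1 : z t 1%N = a1%:R - b1%:R by rewrite /z /tuple_nth tuple_codeK.
  have zE4 : z t 4 = a2%:R - b2%:R by rewrite /z /tuple_nth tuple_codeK.
  have zE6 : z t 6 = - m%:~R by rewrite /z /tuple_nth tuple_codeK -E3 intrN.
  have cE : c (pair_code ci rj) = any_rational i by rewrite /c pair_fstK.
  have rE : r (pair_code ci rj) = any_rational j by rewrite /r pair_sndK.
  have e1E : any_rational i - any_rational j = (u t 0%N)%:num + z t 1%N.
    by rewrite -k1E E1 uE0 zE1.
  have e2E : any_rational i + any_rational j = (u t 3)%:num + z t 4.
    by rewrite -k2E E2 uE3 zE4.
  rewrite cE rE zE6 -!GE -e1E -e2E; split=> //.
    have := uvP (any_rational i - any_rational j) ltac:(lra).
    by rewrite ltr_norml; lra.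
  have := uvP (any_rational i + any_rational j) ltac:(lra).
  by rewrite ltr_norml; lra.
move=> [e [t [e1E e2E Gl Gr]]] /distE[m].
rewrite ltr_norml => /andP[xl xr].
rewrite /= circle_T_to_circle //; apply/distE.
rewrite -!GE -e1E -e2E in Gl Gr.
have GxE : G x + m%:~R = G (x + m%:~R) by rewrite line_liftDz.
have [k kE] := intz t 6.
have Gl' : G (c e - r e) <= G (x + m%:~R) by apply: G_mono; lra.
have Gr' : G (x + m%:~R) <= G (c e + r e) by apply: G_mono; lra.
(* [m] brings [x] into the chosen lift of the source ball, and [k] shifts the target; only their
   difference matters. *)
exists (m - k); rewrite intrB -kE ltr_norml; apply/andP; split; lra.
Qed.

End ComputableMap.

(** * Invariant measures of T *)

Section CircleTopology.
Context {R : realType}.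
Local Notation S := (borel_circle R).

Lemma open_lineP (A : set R) :
  (forall y, A y -> exists2 d, 0 < d & forall z, `|z - y| < d -> A z) -> open A.
Proof.
move=> AP; rewrite openE => y /AP[d d0 dA]; apply/nbhs_ballP; exists d => // z.
by rewrite /ball /= distrC; exact: dA.
Qed.

(** In the quotient topology a set is open exactly when its preimage in R is. *)
Lemma measurable_open_preimage (A : set (circle R)) :
  (forall y, A (to_circle y) ->
    exists2 d, 0 < d & forall z, `|z - y| < d -> A (to_circle z)) ->
  measurable (A : set S).
Proof.
move=> AP; apply: sub_sigma_algebra.
exact: (open_lineP (A := @to_circle R @^-1` A)).
Qed.

Lemma measurable_lipschitz1 (g : S -> R) : lipschitz1 g -> measurable_fun setT g.
Proof.
move=> gL; apply: (measurability _ (measurable_realfun.RGenOInfty.measurableE R)).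
move=> _ [_ [x ->] <-]; rewrite setTI; apply: measurable_open_preimage => y /=.
rewrite in_itv /= andbT => xg; exists (g (to_circle y) - x); first by rewrite subr_gt0.
move=> z zy; rewrite in_itv /= andbT.
suff : `|g (to_circle z) - g (to_circle y)| < g (to_circle y) - x.
  by rewrite ltr_norml; lra.
apply: le_lt_trans (gL _ _) _; apply/circle_dist_ltP; exists 0.
by rewrite subr0.
Qed.

Lemma circle_dist_le1 (s t : circle R) : circle_dist s t <= 1.
Proof.
apply: ltW; rewrite -(to_circle_frac s) -(to_circle_frac t).
apply/circle_dist_ltP; exists 0; rewrite subr0 ltr_norml.
have := circle_frac_ge0 s; have := circle_frac_lt1 s.
have := circle_frac_ge0 t; have := circle_frac_lt1 t; lra.
Qed.

Lemma mass_circle (mu : probability S R) : mu setT = 1%E.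
Proof. exact: probability_setT. Qed.

Lemma circle_negligibleP (mu : probability S R) (A : set S) : measurable A ->
  mu.-negligible A <-> mu A = 0%E.
Proof. exact: negligibleP. Qed.

Lemma integrable_lipschitz1 (mu : probability S R) (g : S -> R) :
  lipschitz1 g -> mu.-integrable setT (EFin \o g).
Proof.
move=> gL; apply: measurable_bounded_integrable => //.
- by move: (ltry (1 : R)); rewrite -(mass_circle mu).
- exact: measurable_lipschitz1.
- exists (`|g point| + 1); split=> // M gM x _ /=.
  apply: le_trans (ltW gM); rewrite -(subrK (g point) (g x)) addrC.
  apply: le_trans (ler_normD _ _) _; rewrite lerD2l.
  exact: le_trans (gL _ _) (circle_dist_le1 _ _).
Qed.

(** The supremum dominates its elements only if they are bounded. The circle has diameter at most 1,
    so all integrals of [h] lie within 1 of [h point], whence the bound 2. *)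
Lemma W1_ge (mu1 mu2 : probability S R) (g : S -> R) : lipschitz1 g ->
  `|\int[mu1]_x g x - \int[mu2]_x g x| <= W1 mu1 mu2.
Proof.
move=> gL; apply: ub_le_sup; last by exists g.
exists 2 => _ [h hL ->].
have bound (mu : probability S R) :
    h point - 1 <= \int[mu]_x h x <= h point + 1.
  have cst r : \int[mu]_x r = r.
    have rE : r * fine (mu [set: S]) = r by rewrite mass_circle mulr1.
    by rewrite -[RHS]rE Rintegral_cst.
  have ih := integrable_lipschitz1 mu hL.
  have hP x := le_trans (hL x point) (circle_dist_le1 x point).
  rewrite -(cst (h point - 1)) -(cst (h point + 1)); apply/andP; split.
    apply: le_Rintegral => //; first exact: finite_measure_integrable_cst.
    by move=> x _; have := hP x; rewrite ler_norml; lra.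
  apply: le_Rintegral => //; first exact: finite_measure_integrable_cst.
  by move=> x _; have := hP x; rewrite ler_norml; lra.
by have := bound mu1; have := bound mu2; rewrite ler_norml; lra.
Qed.

Lemma circle_frac_to_circle (y : R) :
  circle_frac (to_circle y) = y - (Num.floor y)%:~R.
Proof.
have /to_circle_eq/intrP[m mE] := to_circle_frac (to_circle y).
suff -> : Num.floor y = - m :> int by rewrite intrN; lra.
apply: floor_def; rewrite intrD intrN.
by have := circle_frac_ge0 (to_circle y); have := circle_frac_lt1 (to_circle y); lra.
Qed.

(* The terms x and 1 - x make the tent vanish at 0 and 1, so that its periodic
   extension is 1-Lipschitz. *)
Definition tent (c r x : R) : R :=
  Num.max 0 (Num.min (r - `|x - c|) (Num.min x (1 - x))).

Definition circle_tent (c r : R) (s : S) : R := tent c r (circle_frac s).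

Lemma tent_bounds (c r x : R) : 0 <= x <= 1 ->
  [/\ 0 <= tent c r x, tent c r x <= x & tent c r x <= 1 - x].
Proof.
move=> /andP[x0 x1]; rewrite /tent le_max lexx !ge_max !ge_min !lexx !orbT.
by rewrite x0 subr_ge0 x1.
Qed.

Lemma tent_lipschitz (c r x y : R) : x <= y -> `|tent c r x - tent c r y| <= y - x.
Proof.
move=> xy; rewrite /tent.
have maxL (a b : R) : `|Num.max 0 a - Num.max 0 b| <= `|a - b|.
  by case: (leP 0 a) (leP 0 b) => ? []?; case: (ger0P (a - b)) => ?; rewrite ?ler_norml; lra.
have minL (a b a' b' d : R) : `|a - a'| <= d -> `|b - b'| <= d ->
    `|Num.min a b - Num.min a' b'| <= d.
  by rewrite !ler_norml; case: (leP a b) (leP a' b') => ? [] ?; lra.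
apply: le_trans (maxL _ _) _; apply: (minL); last apply: (minL).
- by case: (ger0P (x - c)) (ger0P (y - c)) => ? [] ?; rewrite ler_norml; lra.
- by rewrite ler_norml; lra.
- by rewrite ler_norml; lra.
Qed.

Lemma tent_gt0 (c r x : R) : (0 < tent c r x) = [&& 0 < x, x < 1 & `|x - c| < r].
Proof.
by rewrite /tent lt_max ltxx /= !lt_min !subr_gt0 andbC -andbA.
Qed.

Lemma circle_tent_lipschitz1 (c r : R) : lipschitz1 (circle_tent c r).
Proof.
have key (x y : R) : x <= y ->
    `|circle_tent c r (to_circle x) - circle_tent c r (to_circle y)| <= y - x.
  move=> xy; rewrite /circle_tent !circle_frac_to_circle.
  have x0 := frac_ge0 x; have x1 := frac_lt1 x.
  have y0 := frac_ge0 y; have y1 := frac_lt1 y.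
  have := le_floor xy; rewrite le_eqVlt => /orP[/eqP E|].
    by rewrite E in x0 x1 *; apply: le_trans (tent_lipschitz _ _ _) _; lra.
  (* Some integer separates [x] from [y], and each tent value is at most the distance from its point
     to the nearest integer on that side. *)
  rewrite -lezD1 -(ler_int R) intrD => xy1.
  have [|tx0 _ tx1] := @tent_bounds c r (x - (Num.floor x)%:~R); first by lra.
  have [|ty0 ty1 _] := @tent_bounds c r (y - (Num.floor y)%:~R); first by lra.
  by rewrite ler_norml; lra.
move=> s t; apply: lb_le_inf; first by exists `|circle_frac s - circle_frac t|,
  (circle_frac s), (circle_frac t); rewrite !to_circle_frac.
move=> _ [x [y [<- <- ->]]].
have [xy|/ltW yx] := leP x y.
  by apply: le_trans (key _ _ xy) _; rewrite distrC; exact: ler_norm.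
by rewrite distrC; apply: le_trans (key _ _ yx) _; exact: ler_norm.
Qed.

End CircleTopology.

(** * Invariant measures of a monotone map with a fixed point *)

Section MonotoneLift.
Context {R : realType}.
Local Notation S := (borel_circle R).
Variables (T : circle R -> circle R) (G : R -> R) (k0 : R).
Hypothesis T_lifts : forall x, T (to_circle x) = to_circle (G x).
Hypothesis G_nondecreasing : forall x y, x <= y -> G x <= G y.
Hypothesis GDz : forall (x : R) (m : int), G (x + m%:~R) = G x + m%:~R.
Hypothesis G_near : forall x d : R, 0 < d -> exists u v,
  [/\ u < x, x < v & forall y, u <= y <= v -> `|G y - G x| < d].
Hypothesis G_ge : forall x, x <= G x.
Hypothesis G_fixed : G k0 = k0.

Definition arc (u v : R) : set (circle R) :=
  [set s | exists2 x, u < x < v & to_circle x = s].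

Lemma arc_near u v y : arc u v (to_circle y) ->
  exists2 d, 0 < d & forall z, `|z - y| < d -> arc u v (to_circle z).
Proof.
move=> [x /andP[ux xv] /to_circle_eq xy]; exists (Num.min (x - u) (v - x)).
  by rewrite lt_min !subr_gt0 ux.
move=> z; rewrite lt_min !ltr_norml => zy; exists (x + (z - y)); first by lra.
by apply/to_circle_eq; rewrite (_ : _ - z = x - y) //; lra.
Qed.

Lemma measurable_arc u v : measurable (arc u v : set S).
Proof. by apply: measurable_open_preimage => y; exact: arc_near. Qed.

Lemma measurable_preimage_arc u v : measurable (T @^-1` arc u v : set S).
Proof.
apply: measurable_open_preimage => y; rewrite /preimage /mkset T_lifts.
move=> /arc_near[d d0 dP]; have [a [b [ay yb abP]]] := G_near y d0.
exists (Num.min (y - a) (b - y)); first by rewrite lt_min !subr_gt0 ay.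
move=> z; rewrite lt_min !ltr_norml T_lifts => zy; apply/dP/abP; lra.
Qed.

Lemma circle_representative s : exists2 x, k0 < x <= k0 + 1 & to_circle x = s.
Proof.
rewrite -(to_circle_frac s); set y := circle_frac s.
have f0 := frac_ge0 (k0 - y); have f1 := frac_lt1 (k0 - y).
(* Subtracting a fractional part, which lies in [0, 1[, yields an interval open on the left and
   closed on the right. *)
exists (k0 + 1 - (k0 - y - (Num.floor (k0 - y))%:~R)); first by lra.
apply/to_circle_eq.
rewrite (_ : _ - y = (1 + Num.floor (k0 - y))%:~R) ?intr_int //.
by rewrite intrD; lra.
Qed.

Lemma circle_representative_inj x y : k0 < x <= k0 + 1 -> k0 < y <= k0 + 1 ->
  to_circle x = to_circle y -> x = y.
Proof.
move=> kx ky /to_circle_eq/intrP[m mE].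
have : -1 < m < 1 by rewrite -(ltr_int R) -(ltr_int R) -mE; apply/andP; split; lra.
by case: m mE => [[|m]|[|m]] //= mE _; apply/eqP; rewrite -subr_eq0 mE.
Qed.

(* The arc ]q, k0 + 1], which T maps into itself. *)
Definition upper_arc (q : R) : set S :=
  arc q (k0 + 1) `|` ~` arc k0 (k0 + 1).

(** The complement of [arc k0 (k0 + 1)] is the single point [to_circle k0], represented here by
    [k0 + 1]; it supplies the closed end of the arc. *)
Lemma upper_arcE q x : k0 <= q < k0 + 1 -> k0 < x <= k0 + 1 ->
  upper_arc q (to_circle x) <-> q < x.
Proof.
move=> kq kx; split=> [[[y qy /circle_representative_inj yx]|nx]|qx].
- by have -> : x = y; [apply/esym/yx => //; lra|lra].
- rewrite ltNge; apply/negP => xq; apply: nx; exists x => //; lra.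
have [xk|kx1] := ltP x (k0 + 1); first by left; exists x => //; lra.
right=> -[y ky /circle_representative_inj yx].
by have : y = x; [apply: yx; lra|lra].
Qed.

(** The fixed point [k0 + 1] is a barrier: monotonicity keeps images below it, so moving forward
    never wraps around. *)
Lemma lift_interval x : k0 < x <= k0 + 1 -> k0 < G x <= k0 + 1.
Proof.
move=> /andP[kx xk]; have := G_ge x; have := G_nondecreasing xk.
by rewrite -[X in G (k0 + X)]/(1%:~R) GDz G_fixed; lra.
Qed.

Lemma upper_arc_stable q : k0 <= q < k0 + 1 -> upper_arc q `<=` T @^-1` upper_arc q.
Proof.
move=> kq s; have [x kx <-] := circle_representative s.
move=> /(upper_arcE kq kx) qx; rewrite /preimage /= T_lifts.
by apply/(upper_arcE kq (lift_interval kx)); exact: lt_le_trans qx (G_ge x).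
Qed.

Lemma moved_set_null (mu : probability S R) (A : set S) :
  invariant_measure T mu -> measurable A ->
  (forall x, A (to_circle x) -> x < G x) -> mu A = 0%E.
Proof.
move=> mu_inv mA AP.
have mU q : measurable (upper_arc q).
  by apply: measurableU; [exact: measurable_arc|apply: measurableC; exact: measurable_arc].
have mTU q : measurable (T @^-1` upper_arc q : set S).
  rewrite /upper_arc preimage_setU preimage_setC; apply: measurableU.
    exact: measurable_preimage_arc.
  by apply: measurableC; exact: measurable_preimage_arc.
(* Points entering the arc at the rational of index [j]; the set is empty if that rational is
   outside [k0, k0 + 1[, so the union can run over all indices. *)
pose D j : set S := [set s | k0 <= any_rational j < k0 + 1 /\
  (T @^-1` upper_arc (any_rational j) `\` upper_arc (any_rational j)) s].
have Dnull j : mu.-negligible (D j).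
  have [kj|kj] := boolP (k0 <= (any_rational j : R) < k0 + 1); last first.
    by apply: negligibleS (negligible_set0 _) => s [] /(negP kj).
  exists (T @^-1` upper_arc (any_rational j) `\` upper_arc (any_rational j)).
  split; [exact: measurableD| |by move=> s []].
  have fin : (mu (T @^-1` upper_arc (any_rational j)) < +oo)%E.
    exact: le_lt_trans (probability_le1 _ (mTU _)) (ltry _).
  rewrite measureD // setIidr; last exact: upper_arc_stable.
  have : (mu (upper_arc (any_rational j)) - mu (upper_arc (any_rational j)) = 0)%E.
    by rewrite subee // fin_num_measure.
  by rewrite {1}(mu_inv _ (mU (any_rational j))).
apply/negligibleP => //; apply: negligibleS (negligible_bigcup Dnull).
move=> s; have [x kx <-] := circle_representative s => /AP xG.
have kG := lift_interval kx.
(* The arc starting at such a rational contains [G x] but not [x]. *)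
have [j /andP[xj jG]] := any_rational_dense xG.
have kj : k0 <= (any_rational j : R) < k0 + 1 by lra.
exists j => //; split=> //; split.
  by rewrite /preimage /= T_lifts; apply/(upper_arcE kj kG).
by move=> /(upper_arcE kj kx); lra.
Qed.

End MonotoneLift.

(** * Integrals of tents with respect to ideal measures *)

Section IdealMeasures.
Context {R : realType}.
Local Notation S := (borel_circle R).

Lemma integral_ideal_measure n (g : S -> R) : (forall s, 0 <= g s) -> lipschitz1 g ->
  \int[@ideal_measure R n]_s g s = \sum_(k < ideal_size n)
    (ideal_weight n k)%:R / (ideal_total n)%:R * g (ideal_atom R n k).
Proof.
move=> g0 gL; have mg := measurable_lipschitz1 gL.
have mEg : measurable_fun (setT : set S) (fun s : S => (g s)%:E).
  exact/measurable_EFinP.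
rewrite /Rintegral /ideal_measure /= /ideal_measure_fun.
rewrite ge0_integral_measure_sum //; last by move=> s _; rewrite lee_fin.
rewrite (eq_bigr (fun k : 'I__ => ((ideal_weight n k)%:R / (ideal_total n)%:R *
  g (ideal_atom R n k))%:E)); last first.
  move=> k _; rewrite ge0_integral_mscale //; last by move=> s _; rewrite lee_fin.
  by rewrite integral_dirac // diracT mul1e.
by rewrite sumEFin.
Qed.

(** The fractional part of [a / b] is [(a mod b) / b]; the remainder is found by search, as the
    number below [b] that admits a quotient. *)
Lemma qrec_circle_tent (c r : nat -> R) (x : nat -> nat) : qrec c -> qrec r ->
  total_recursive x ->
  qrec (fun n => circle_tent (c n) (r n) (to_circle (nneg_rational (x n) : R))).
Proof.
move=> qc qr tx.
apply: (@qrec_ext _ (fun n => tent (c n) (r n)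
    ((pair_fst (x n) %% (pair_snd (x n)).+1)%N%:R / (pair_snd (x n)).+1%:R))).
  move=> n; rewrite /circle_tent circle_frac_to_circle; congr tent.
  rewrite /nneg_rational; set a := pair_fst _; set b := (pair_snd _).+1.
  have b0 : 0 < b%:R :> R by [].
  have aE : a%:R / b%:R = (a %/ b)%N%:R + (a %% b)%N%:R / b%:R :> R.
    by rewrite {1}(divn_eq a b) natrD natrM mulrDl mulfK ?gt_eqF.
  suff -> : Num.floor (a%:R / b%:R : R) = (a %/ b)%N :> int.
    by rewrite aE -pmulrn addrAC subrr add0r.
  apply: floor_def; rewrite aE intrD -!pmulrn lerDl divr_ge0 //= ltrD2l.
  by rewrite ltr_pdivrMr // mul1r ltr_nat ltn_mod.
have [phi tphi phiP] : exists2 phi, total_recursive phi &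
    forall n, exists k, (pair_fst (x n) = k * (pair_snd (x n)).+1 + phi n /\
      phi n < (pair_snd (x n)).+1)%N.
  apply: (@sigma1_select (fun n y => exists k,
    (pair_fst (x n) = k * (pair_snd (x n)).+1 + y /\ y < (pair_snd (x n)).+1)%N)).
    have tx' : total_recursive (fun m => x (pair_fst (pair_fst m))).
      by apply: total_recursive_comp tx _; rec.
    by apply: sigma1_ex; apply: sigma1_and; [apply: sigma1_eq|apply: sigma1_ltn]; rec.
  move=> n; exists (pair_fst (x n) %% (pair_snd (x n)).+1)%N.
  by exists (pair_fst (x n) %/ (pair_snd (x n)).+1)%N; rewrite -divn_eq ltn_mod.
have modE n : (pair_fst (x n) %% (pair_snd (x n)).+1)%N = phi n.
  by have [k [-> lt]] := phiP n; rewrite modnMDl modn_small.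
have qx : qrec (fun n => (pair_fst (x n) %% (pair_snd (x n)).+1)%N%:R /
    (pair_snd (x n)).+1%:R : R).
  apply: (@qrec_ext _ (fun n => (phi n)%:R / (pair_snd (x n)).+1%:R)).
    by move=> n; rewrite modE.
  by apply: qrec_mul; [exact: qrec_nat|apply: qrec_inv; rec].
apply: qrec_max; first exact: qrec_0.
apply: qrec_min; first exact: qrec_sub qr (qrec_norm (qrec_sub qx qc)).
by apply: qrec_min => //; exact: qrec_sub qrec_1 qx.
Qed.

Lemma qrec_integral_tent (c r : nat -> R) (i : nat -> nat) : qrec c -> qrec r ->
  total_recursive i ->
  qrec (fun n => \int[@ideal_measure R (i n)]_s circle_tent (c n) (r n) s).
Proof.
move=> qc qr ti.
pose term (n k : nat) := (nth 0 (pair_fst n :: tuple_decode (pair_snd n)) k)%N.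
have tterm f k : total_recursive f -> total_recursive k ->
    total_recursive (fun n => term (f n) (k n)).
  (* The list of terms coded by [n] is [tuple_decode n.+1]. *)
  move=> tf tk; have := rec_tuple_nth (rec_succ tf) tk.
  by congr total_recursive; apply/funext => n; rewrite /tuple_nth tuple_decodeS.
have tsize : total_recursive (fun n => ideal_size (i n)).
  by apply: rec_succ; apply: rec_size; rec.
apply: (@qrec_ext _ (fun n => \sum_(k < ideal_size (i n))
   (pair_fst (term (i n) k)).+1%:R / (ideal_total (i n)).-1.+1%:R *
   circle_tent (c n) (r n) (to_circle (nneg_rational (pair_snd (term (i n) k)))))).
  move=> n; rewrite integral_ideal_measure; last exact: circle_tent_lipschitz1; last first.
    move=> s; have [|//] := @tent_bounds R (c n) (r n) (circle_frac s).
    by rewrite circle_frac_ge0 ltW // circle_frac_lt1.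
  apply: eq_bigr => k _; rewrite prednK //.
  by rewrite /ideal_total /ideal_size /= big_ord_recl.
have ti' : total_recursive (fun m => i (pair_fst m)).
  by apply: total_recursive_comp ti _; rec.
apply: (@qrec_sum _ _ (fun n k => (pair_fst (term (i n) k)).+1%:R / (ideal_total (i n)).-1.+1%:R *
   circle_tent (c n) (r n) (to_circle (nneg_rational (pair_snd (term (i n) k)))))) => //.
have tt := tterm _ _ ti' (rec_snd rec_id).
apply: qrec_mul; first apply: qrec_mul.
- by apply: qrec_nat; rec.
- apply: qrec_inv; apply: rec_pred.
  apply: (@rec_sum (fun m => ideal_size (i (pair_fst m)))
     (fun m k => (pair_fst (term (i (pair_fst m)) k)).+1)).
    by apply: total_recursive_comp tsize _; rec.
  apply: rec_succ; apply: rec_fst; apply: tterm; last by rec.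
  by apply: total_recursive_comp ti' _; rec.
- by apply: qrec_circle_tent; [apply: qrec_comp qc _|apply: qrec_comp qr _|]; rec.
Qed.

End IdealMeasures.

(** * Extracting a computable point of K from a computable measure *)

Section ComputableSupport.
Context {R : realType}.
Local Notation S := (borel_circle R).
Variable mu : probability S R.

Definition tent_set (c r : R) : set S := [set s | 0 < circle_tent c r s].

Lemma measurable_tent_set c r : measurable (tent_set c r).
Proof.
have := measurable_lipschitz1 (@circle_tent_lipschitz1 R c r).
move=> /(_ measurableT `]0, +oo[%classic (measurable_itv _)); rewrite setTI.
by congr measurable; apply/seteqP; split=> s /=; rewrite in_itv /= andbT.
Qed.

Lemma circle_tent_ge0 (c r : R) s : 0 <= circle_tent c r s.
Proof.
have [|//] := @tent_bounds R c r (circle_frac s).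
by rewrite circle_frac_ge0 ltW // circle_frac_lt1.
Qed.

(** A nonnegative function has zero integral only if it vanishes almost everywhere. This turns a
    condition on mass into one on numbers that can be approximated. *)
Lemma integral_tent_gt0 c r :
  0 < \int[mu]_s circle_tent c r s <-> mu (tent_set c r) <> 0%E.
Proof.
have int_tent := integrable_lipschitz1 mu (@circle_tent_lipschitz1 R c r).
have mt : measurable_fun (setT : set S) (fun s : S => (circle_tent c r s)%:E).
  by have /integrableP[] := int_tent.
have fin : (\int[mu]_s (circle_tent c r s)%:E)%E \is a fin_num.
  exact: integrable_fin_num.
have abs_tent : (\int[mu]_s `|(circle_tent c r s)%:E| = \int[mu]_s (circle_tent c r s)%:E)%E.
  by apply: eq_integral => s _; rewrite gee0_abs // lee_fin circle_tent_ge0.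
have zeroE : (\int[mu]_s (circle_tent c r s)%:E = 0)%E <-> mu (tent_set c r) = 0%E.
  rewrite -abs_tent; apply: iff_trans (ae_eq_integral_abs mu measurableT mt) _.
  have mL := measurable_tent_set c r; split=> [[N [mN N0 NP]]|L0].
    apply/(circle_negligibleP mu mL); exists N; split=> // s s0; apply: NP => /(_ I) [sE].
    by move: s0; rewrite /tent_set /= sE ltxx.
  exists (tent_set c r); split=> // s /= H; rewrite /tent_set /= lt_neqAle circle_tent_ge0 andbT.
  by apply/eqP => sE; apply: H => _; rewrite -sE.
have int0 : 0 <= \int[mu]_s circle_tent c r s.
  by apply: Rintegral_ge0 => s _; exact: circle_tent_ge0.
split=> [int_gt0 /zeroE I0|/zeroE I0].
  by move: int_gt0; rewrite /Rintegral I0 ltxx.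
rewrite lt_neqAle int0 andbT; apply/eqP => I1; apply: I0.
by rewrite -(fineK fin) -[fine _]/(\int[mu]_s circle_tent c r s) -I1.
Qed.

(** Tent sets of radius [r'] with rational centres near [c] form a countable cover; they cannot all
    be null. *)
Lemma tent_set_refine c r r' : 0 < r' -> mu (tent_set c r) <> 0%E ->
  exists j, `|any_rational j - c| < r /\ mu (tent_set (any_rational j) r') <> 0%E.
Proof.
move=> r'0 Lcr; apply: contrapT => noj; apply: Lcr.
apply/(circle_negligibleP mu (measurable_tent_set c r)).
pose D j : set S := [set s | `|any_rational j - c| < r /\ tent_set (any_rational j) r' s].
have Dnull j : mu.-negligible (D j).
  have [jr|jr] := boolP (`|any_rational j - c| < r); last first.
    by apply: negligibleS (negligible_set0 _) => s [] /(negP jr).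
  apply: negligibleS (_ : mu.-negligible (tent_set (any_rational j) r')); first by move=> s [].
  apply/circle_negligibleP; first exact: measurable_tent_set.
  by apply: contrapT => Lj; apply: noj; exists j.
apply: negligibleS (negligible_bigcup Dnull) => s.
rewrite /tent_set /circle_tent /mkset tent_gt0; set x := circle_frac s.
move=> /and3P[x0 x1]; rewrite ltr_norml => xc.
(* A centre just below [x]: within [r'] of [x], and above [c - r]. Being below [x], it is also below
   [c + r]. *)
have [|j /andP[jl jx]] := @any_rational_dense R (Num.max (x - r') (c - r)) x.
  by rewrite gt_max; lra.
move: jl; rewrite gt_max => /andP[jr' jr].
exists j => //; split; first by rewrite ltr_norml; lra.
by rewrite /tent_set /circle_tent /mkset tent_gt0 -/x x0 x1 /= ltr_norml; lra.
Qed.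

Variable K : set R.
Hypothesis K_closed : closed K.
Hypothesis K_gt0 : forall x, K x -> 0 < x.
Hypothesis mu_K : forall A : set S, measurable A ->
  (forall s, A s -> ~ K (circle_frac s)) -> mu A = 0%E.

Lemma tent_set_meets c r : mu (tent_set c r) <> 0%E -> exists2 x, K x & `|x - c| < r.
Proof.
move=> L; apply: contrapT => noK; apply: L; apply: mu_K.
  exact: measurable_tent_set.
move=> s; rewrite /tent_set /circle_tent /= tent_gt0 => /and3P[_ _ sc] Ks.
by apply: noK; exists (circle_frac s).
Qed.

(** Centre 1/2 and radius 1 make the tent positive on all of ]0, 1[; only the point 0 is left out,
    and it is not in K. *)
Lemma tent_set_start j : any_rational j = 2^-1 :> R ->
  mu (tent_set (any_rational j) 1) <> 0%E.
Proof.
move=> jE L0; have mL := measurable_tent_set (any_rational j) 1.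
have /eqP := mass_circle mu.
have : mu (~` tent_set (any_rational j) 1) = 0%E.
  apply: mu_K => [|s]; first exact: measurableC.
  rewrite /tent_set /circle_tent /= tent_gt0 jE => + /K_gt0 s0.
  have s1 := circle_frac_lt1 s; apply; rewrite s0 s1 ltr_norml; lra.
by rewrite probability_setC // L0 sube0 => /eqP; rewrite onee_eq0.
Qed.

(** The factor 2 is the sum of the geometric series of steps; it makes the intervals [u n, v n]
    nested. *)
Lemma limit_of_nested (c : nat -> R) : (forall n, `|c n.+1 - c n| < 2^-1 ^+ n) ->
  exists x, forall n, `|x - c n| <= 2 * 2^-1 ^+ n.
Proof.
move=> cP; pose u n := c n - 2 * 2^-1 ^+ n; pose v n := c n + 2 * 2^-1 ^+ n.
have uS n : u n <= u n.+1.
  by have := cP n; rewrite /u exprS ltr_norml; lra.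
have vS n : v n.+1 <= v n.
  by have := cP n; rewrite /v exprS ltr_norml; lra.
have u_nd : nondecreasing_seq u by apply/nondecreasing_seqP.
have v_ni : nonincreasing_seq v by apply/nonincreasing_seqP.
have uv n : u n <= v n by rewrite /u /v; have := @exp_half_gt0 R n; lra.
have umvn m n : u m <= v n.
  have [mn|/ltnW nm] := leqP m n; first exact: le_trans (u_nd _ _ mn) (uv n).
  exact: le_trans (uv m) (v_ni _ _ nm).
exists (sup (range u)) => n.
have ux : u n <= sup (range u).
  by apply: ub_le_sup; [exists (v 0%N) => _ [m _ <-]|exists n].
have xv : sup (range u) <= v n.
  by apply: ge_sup; [exists (u n), n|move=> _ [m _ <-]].
by rewrite ler_norml; move: ux xv; rewrite /u /v; lra.
Qed.

Lemma computable_support_point : computable_point (measure_cms R) mu ->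
  exists2 x, K x & computable_point (real_cms R) x.
Proof.
move=> [phi tphi phiP].
pose I (c r : R) m := \int[@ideal_measure R (phi m)]_s circle_tent c r s.
have IP c r m : `|I c r m - \int[mu]_s circle_tent c r s| < 2^-1 ^+ m.
  exact: le_lt_trans (W1_ge _ _ (@circle_tent_lipschitz1 R c r)) (phiP m).
(* [p] pairs the index of a centre with a precision [m]. As the approximate integral is off by less
   than [2^-m], exceeding [2^-m] proves the true one positive. *)
pose good n p := 2^-1 ^+ pair_snd p < I (any_rational (pair_fst p)) (2^-1 ^+ n) (pair_snd p).
have good_mu n p : good n p -> mu (tent_set (any_rational (pair_fst p)) (2^-1 ^+ n)) <> 0%E.
  move=> gp; apply/integral_tent_gt0.
  have := IP (any_rational (pair_fst p)) (2^-1 ^+ n) (pair_snd p).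
  by move: gp; rewrite /good ltr_norml; lra.
have mu_good n j : mu (tent_set (any_rational j) (2^-1 ^+ n)) <> 0%E ->
    exists p, pair_fst p = j /\ good n p.
  move=> /integral_tent_gt0 I0.
  have [|m mI] := @exp_half_small R
    ((\int[mu]_s circle_tent (any_rational j) (2^-1 ^+ n) s) / 2).
    by lra.
  exists (pair_code j m); rewrite /good !pairK; split=> //.
  by have := IP (any_rational j) (2^-1 ^+ n) m; rewrite ltr_norml; lra.
pose next n p p' := `|any_rational (pair_fst p') - any_rational (pair_fst p)| < 2^-1 ^+ n :> R /\
  good n.+1 p'.
have qI n p : total_recursive n -> total_recursive p ->
    qrec (fun m => I (any_rational (pair_fst (p m))) (2^-1 ^+ (n m)) (pair_snd (p m))).
  move=> tn tp; apply: (@qrec_integral_tent R (fun m => any_rational (pair_fst (p m)))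
    (fun m => 2^-1 ^+ n m) (fun m => phi (pair_snd (p m)))).
  - by apply: qrec_any; rec.
  - exact: qrec_exp.
  - by apply: total_recursive_comp tphi _; rec.
(* [good n p] being decidable, the search is total: it stops at once when p is
   not good, and by tent_set_refine otherwise. *)
have [||step tstep stepP] := @sigma1_select (fun q p' =>
    I (any_rational (pair_fst (pair_snd q))) (2^-1 ^+ pair_fst q) (pair_snd (pair_snd q)) <=
      2^-1 ^+ pair_snd (pair_snd q) \/ next (pair_fst q) (pair_snd q) p').
- apply: sigma1_or.
    apply: sigma1_ler; last by apply: qrec_exp; rec.
    by apply: (qI (fun q => pair_fst (pair_fst q)) (fun q => pair_snd (pair_fst q))); rec.
  apply: sigma1_and; last first.
    apply: sigma1_ltr; first by apply: qrec_exp; rec.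
    by apply: (qI (fun q => (pair_fst (pair_fst q)).+1) (fun q => pair_snd q)); rec.
  apply: sigma1_ltr; last by apply: qrec_exp; rec.
  by apply: qrec_norm; apply: qrec_sub; apply: qrec_any; rec.
- move=> q; set n := pair_fst q; set p := pair_snd q.
  have [bad|gp] := leP (I (any_rational (pair_fst p)) (2^-1 ^+ n) (pair_snd p))
    (2^-1 ^+ pair_snd p).
    by exists 0%N; left.
  have [j [jp Lj]] := tent_set_refine (@exp_half_gt0 R n.+1) (good_mu n p gp).
  by have [p' [p'j gp']] := mu_good _ _ Lj; exists p'; right; split; rewrite ?p'j.
have [j0 j0E] : exists j, any_rational j = 2^-1 :> R.
  by have [j jE] := @any_rational_ratr R 2^-1; exists j; rewrite jE fmorphV rmorph_nat.
(* The initial radius is [2^-0 = 1]. *)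
have [p0 [_ gp0]] := mu_good 0%N j0 (tent_set_start j0E).
pose sigma n := prec p0 (fun i p => step (pair_code i p)) n.
have tsigma : total_recursive sigma.
  apply: (@rec_prec id (fun=> p0) (fun _ i p => step (pair_code i p))); rec.
  by apply: total_recursive_comp tstep _; rec.
have sigmaS n : good n (sigma n) -> next n (sigma n) (sigma n.+1).
  move=> gn; have := stepP (pair_code n (sigma n)); rewrite !pairK => -[|//].
  by rewrite leNgt => /negP; case.
have sigma_good n : good n (sigma n) by elim: n => // n /sigmaS[].
pose c n : R := any_rational (pair_fst (sigma n)).
have [x xP] : exists x, forall n, `|x - c n| <= 2 * 2^-1 ^+ n.
  by apply: limit_of_nested => n; have [] := sigmaS _ (sigma_good n).
exists x; last first.
  (* The limit is within [2 * 2^-(n+2)] of the centre of rank [n + 2], hence strictly within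
     [2^-n]. *)
  exists (fun n => pair_fst (sigma n.+2)).
    by apply: rec_fst; apply: total_recursive_comp tsigma _; rec.
  move=> n; rewrite /= distrC; apply: le_lt_trans (xP n.+2) _.
  by have := @exp_half_gt0 R n; rewrite !exprS; lra.
apply: K_closed => B /nbhs_ballP[e /= e0 eB].
(* The centre is within [2 * 2^-n] of [x] and within [2^-n] of a point of K: three times [2^-n] in
   all. *)
have [|n ne] := @exp_half_small R (e / 3); first by lra.
have [y Ky yc] := tent_set_meets (good_mu _ _ (sigma_good n)).
exists y; split=> //; apply: eB; rewrite /ball /= -(subrKA (c n)).
apply: le_lt_trans (ler_normD _ _) _; rewrite (distrC (c n) y).
by have := xP n; move: yc; rewrite -/(c n); lra.
Qed.

End ComputableSupport.

Theorem proposition5p1p2 (R : realType) (K : set R)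
    (K01 : K `<=` `[0, 1]%classic)
    (K_nonempty : K !=set0)
    (K_compact : recursively_compact K)
    (K_noncomputable : forall x, K x -> ~ computable_point (real_cms R) x)
    (a b : nat -> R)
    (a_computable : computable_sequence (real_cms R) a)
    (b_computable : computable_sequence (real_cms R) b)
    (ab01 : forall i, [/\ 0 < a i, a i < b i & b i < 1])
    (ab_cover : `]0, 1[%classic `\` K = \bigcup_i `]a i, b i[%classic)
    (f : nat -> {i01 R} -> {i01 R})
    (f_nondecreasing : forall i (x y : {i01 R}),
       x%:num <= y%:num -> (f i x)%:num <= (f i y)%:num)
    (f_computable : uniformly_computable (unit_cms R) (unit_cms R) f)
    (f_in : forall i (x : {i01 R}),
       a i < x%:num < b i -> x%:num < (f i x)%:num)
    (f_out : forall i (x : {i01 R}), ~~ (a i < x%:num < b i) -> f i x = x)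
    (eps : rat) (eps_gt0 : 0 < eps)
    (K_eps : K `<=` `[ratr eps, 1 - ratr eps]%classic) :
  computable_function (circle_cms R) (circle_cms R)
    (circle_T (ratr eps) f) /\
  ~ exists mu : probability (borel_circle R) R,
      invariant_measure (circle_T (ratr eps) f) mu /\
      computable_point (measure_cms R) mu.
Proof.
have [k0 Kk0] := K_nonempty.
have Keps k : K k -> ratr eps <= k <= 1 - ratr eps.
  by move=> /K_eps /=; rewrite in_itv.
have e0 : 0 < (ratr eps : R) by rewrite ltr0q.
(* [k0] lies between [eps] and [1 - eps], which forces [eps] to be at most 1/2. *)
have eps_bounds : 0 < (ratr eps : R) <= 2^-1.
  by have := Keps _ Kk0; rewrite e0 /=; lra.
have K_out k i : K k -> ~~ (a i < k < b i).
  move=> Kk; apply/negP => kab.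
  have : (\bigcup_i `]a i, b i[%classic) k by exists i => //=; rewrite in_itv.
  by rewrite -ab_cover => -[].
have f_ge i (x : {i01 R}) : x%:num <= (f i x)%:num.
  have [xi|xi] := boolP (a i < x%:num < b i); first exact/ltW/f_in.
  by rewrite f_out.
have f0 i : f i 0%:i01 = 0%:i01.
  by apply: f_out; have [a0 _ _] := ab01 i; rewrite /= ltNge ltW.
have f1 i : f i 1%:i01 = 1%:i01.
  by apply: f_out; have [_ _ b1] := ab01 i; rewrite /= andbC ltNge ltW.
split; first exact: computable_circle_T.
move=> [mu [mu_inv mu_comp]].
have contf := computable_continuous f_computable.
pose G := line_lift (ratr eps) f.
have G_lift := circle_T_to_circle eps_bounds f1 f0.
have G_mono := line_lift_nondecreasing eps_bounds f_nondecreasing f1 f0.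
have G_near := line_lift_near eps_bounds f_nondecreasing f1 f0 contf.
have GDz := line_liftDz eps_bounds f1 f0.
have G_ge := line_lift_ge eps_bounds f_ge.
(* On K both [stretch] and every [f i] are the identity, so the partial sums with their error bound
   squeeze the value down to [k0]. *)
have G_fixed : G k0 = k0.
  have k0e := Keps _ Kk0.
  have k00 : 0 <= k0 by lra.
  have k01 : k0 <= 1 by lra.
  pose t : {i01 R} := Itv01 k00 k01.
  have -> : G k0 = T_lift (ratr eps) f t.
    have := line_lift_unit eps_bounds f1 f0 0 t.
    by rewrite add0r addr0.
  apply/eqP; rewrite eq_le (T_lift_ge eps_bounds f_ge t) andbT.
  apply: ler_exp_half => N; have /andP[_ Ft] := T_lift_bounds (ratr eps) f N t.
  apply: le_trans Ft _; rewrite /lift_sum.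
  have st : stretch (ratr eps) t%:num = k0.
    rewrite /stretch /=; case: (leP k0 (ratr eps)) (leP k0 (1 - ratr eps)) => ? [] ?; lra.
  rewrite (eq_bigr (fun i : 'I_N => 2^-1 ^+ i.+2 * k0)) => [|i _]; last first.
    by rewrite f_out //; exact: K_out.
  rewrite -mulr_suml sum_exp_half st.
  have p0 := @exp_half_gt0 R N.+1; have pE : (2^-1 : R) ^+ N = 2 * 2^-1 ^+ N.+1.
    by rewrite exprS; lra.
  have : 0 <= 2^-1 ^+ N.+1 * k0 by rewrite mulr_ge0 // ltW.
  by rewrite pE; lra.
have G_moved x : ~ K (circle_frac (to_circle x)) -> x < G x.
  rewrite circle_frac_to_circle; pose t := unit_frac x => nKt.
  suff : t%:num < T_lift (ratr eps) f t by rewrite /G /line_lift unit_fracE -/t; lra.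
  have t0 := frac_ge0 x; have t1 := frac_lt1 x.
  (* The point 0 is in no ]a i, b i[; there [stretch] equals [eps] and raises the value by at least
     [eps / 2]. *)
  have [tz|tnz] := eqVneq t%:num 0.
    have := T_lift_gap (ratr eps) f_ge t (ord0 : 'I_1).
    have := f_ge 0%N t; rewrite tz subr0 => ft0.
    have : 0 <= 2^-1 ^+ 2 * (f 0%N t)%:num by rewrite mulr_ge0 ?exprn_ge0 ?invr_ge0.
    by rewrite /stretch (ltW e0) /=; lra.
  have tt : 0 < t%:num < 1 by rewrite t1 andbT lt_neqAle eq_sym tnz.
  have [i _ /=] : (\bigcup_i `]a i, b i[%classic) t%:num.
    by rewrite -ab_cover; split => //=; rewrite in_itv.
  rewrite in_itv => abt; have ft := f_in i t abt.
  have := T_lift_gap (ratr eps) f_ge t (ord_max : 'I_i.+1).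
  have : 0 < 2^-1 ^+ i.+2 * ((f i t)%:num - t%:num).
    by rewrite mulr_gt0 ?exp_half_gt0 // subr_gt0.
  have := stretch_ge eps_bounds (ltW t1); rewrite -unit_fracE -/t /=; lra.
have mu_K (A : set (borel_circle R)) : measurable A ->
    (forall s, A s -> ~ K (circle_frac s)) -> mu A = 0%E.
  move=> mA AK; apply: (moved_set_null G_lift G_mono GDz G_near G_ge G_fixed mu_inv mA).
  by move=> x /AK; exact: G_moved.
have K_closed : closed K by apply: compact_closed; [exact: Rhausdorff|case: K_compact].
have K_gt0 x : K x -> 0 < x by move=> /Keps; lra.
have [x Kx] := computable_support_point K_closed K_gt0 mu_K mu_comp.
exact: K_noncomputable.
Qed.
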